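(* Let $A$ be a finite alphabet, $\{F_a:a\in A\}$ a Möbius iterative system and $B\subseteq A^+$ a finite set of nonempty words. Let $\mathcal{W}=\{W_a:a\in A\}$ be an interval almost cover and $\Sigma\subseteq A^\omega$ a subshift compatible with $\mathcal{W}$ such that $W_b\subseteq V_b$ for every $b\in B$ (where $V_b$ is the expansion interval of $F_b^{-1}$) and each $w\in\Sigma_{\mathcal{W}}$ has some $b\in B$ as a prefix. Then $\Sigma_{\mathcal{W}}$ is a Möbius number system for the iterative system $\{F_a:a\in A\}$. Moreover, $\Phi([v]\cap\Sigma_{\mathcal{W}})=\overline{W_v}$ for all $v\in A^*$.
   Context: $\mathbb{T}$ is the unit circle in $\mathbb{C}$. A disc preserving Möbius transformation is a map $F(z)=\frac{\alpha z+\beta}{\overline\beta z+\overline\alpha}$ with $|\alpha|^2-|\beta|^2=1$. Put $F^{\bullet}(x)=|F'(x)|$. The expansion interval of $F^{-1}$ is $\{x\in\mathbb{T}:(F^{-1})^{\bullet}(x)>1\}$ (empty if $F$ is a rotation $z\mapsto e^{i\phi}z$). Words: $A^*$ is the set of finite words over $A$ (including the empty word $\lambda$), $A^+=A^*\setminus\{\lambda\}$, $A^\omega$ the set of one-sided infinite words with the product topology; $w_{[0,n)}=w_0\cdots w_{n-1}$; $[v]$ is the set of $w\in A^\omega$ having $v$ as a prefix. A subshift is a closed set $\Sigma\subseteq A^\omega$ with $\sigma(\Sigma)\subseteq\Sigma$, where $\sigma(w)_i=w_{i+1}$. $\mathcal{L}(\Sigma)$ is the set of all finite words that are factors of some $w\in\Sigma$.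 A Möbius iterative system is a family $\{F_a:a\in A\}$ of disc preserving Möbius transformations. For $v=v_0\cdots v_{n-1}$ put $F_v=F_{v_0}\circ\cdots\circ F_{v_{n-1}}$ ($F_\lambda=\mathrm{id}$). A sequence $\{G_n\}$ of disc preserving Möbius transformations represents $x\in\mathbb{T}$ if $G_n\mu\to\delta_x$ weakly$^*$, where $\mu$ is the uniform probability measure on $\mathbb{T}$, $\delta_x$ is the Dirac measure at $x$ and $G\mu(E)=\mu(G^{-1}(E))$. For $w\in A^\omega$, $\Phi(w)$ is the point $x\in\mathbb{T}$ represented by $\{F_{w_{[0,n)}}\}_{n=1}^\infty$ if it exists, and is undefined otherwise. A subshift $\Sigma'\subseteq A^\omega$ is a Möbius number system for $\{F_a\}$ if $\Phi$ is defined on all of $\Sigma'$, $\Phi(\Sigma')=\mathbb{T}$ and $\Phi|_{\Sigma'}$ is continuous. An interval almost cover is a family $\mathcal{W}=\{W_a:a\in A\}$ where each $W_a$ is a union of finitely many (possibly zero) open intervals on $\mathbb{T}$ and $\bigcup_{a\in A}\overline{W_a}=\mathbb{T}$. Refined sets: $W_\lambda=\mathbb{T}$ and $W_u=W_{u_0}\cap F_{u_0}(W_{u_1})\cap\cdots\cap F_{u_{[0,n-1)}}(W_{u_{n-1}})$ for $u$ of length $n\geq1$. A nonempty subshift $\Sigma$ is compatible with $\mathcal{W}$ if for every $v\in\mathcal{L}(\Sigma)$, $\overline{W_v}=\bigcup_{a\in A,\,va\in\mathcal{L}(\Sigma)}\overline{W_{va}}$. The interval shift is $\Sigma_{\mathcal{W}}=\{w\in\Sigma:\forall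 n,\ W_{w_{[0,n)}}\ne\emptyset\}$ (a subshift).
   Formalization: The formula Φ([v]∩Σ_W) = closure of W_v is stated only for v in L(Σ), not for all v in A*; it fails otherwise, e.g. for a letter c that never occurs in Σ with W_c nonempty, where the left side is empty. *)

(* Defs.v *)
(* Built on MathComp-Analysis over an arbitrary R : realType, with the complex
   numbers R[i] of real-closed. *)
From HB Require Import structures.
From mathcomp Require Import all_boot all_order all_algebra.
From mathcomp Require Import all_classical all_reals all_analysis.
From mathcomp Require Import complex ring.

Set Implicit Arguments.
Unset Strict Implicit.
Unset Printing Implicit Defensive.

Import Order.TTheory GRing.Theory Num.Theory numFieldNormedType.Exports.

Local Open Scope classical_set_scope.
Local Open Scope ring_scope.

(* Seeing R[i] as a numClosedFieldType gives it the topology of its norm and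
   makes `derive1` the complex derivative. *)
Definition C (R : realType) : numClosedFieldType := R[i].

Definition circle (R : realType) : set (C R) := [set z | `|z| = 1].
Arguments circle : clear implicits.

Definition expi (R : realType) (t : R) : C R := Complex (cos t) (sin t).

(* Pairs (alpha, beta) and (-alpha, -beta) give the same map.  The pole of
   z |-> (alpha z + beta) / (beta^* z + alpha^* ) lies outside the closed unit
   disc, so the junk value of `_ / 0` never occurs on the circle nor near it. *)
Record disc_mobius (R : realType) := DiscMobius {
  mob_alpha : C R;
  mob_beta : C R;
  mob_axiom : `|mob_alpha| ^+ 2 - `|mob_beta| ^+ 2 = 1
}.

Definition mob_fun (R : realType) (F : disc_mobius R) (z : C R) : C R :=
  (mob_alpha F * z + mob_beta F) / ((mob_beta F)^* * z + (mob_alpha F)^*).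

Coercion mob_fun : disc_mobius >-> Funclass.

Lemma mob_id_axiom (R : realType) : `|1 : C R| ^+ 2 - `|0 : C R| ^+ 2 = 1.
Proof. by rewrite normr1 normr0 expr1n expr0n subr0. Qed.

Lemma mob_comp_axiom (R : realType) (F G : disc_mobius R) :
  `|mob_alpha F * mob_alpha G + mob_beta F * (mob_beta G)^*| ^+ 2 -
  `|mob_alpha F * mob_beta G + mob_beta F * (mob_alpha G)^*| ^+ 2 = 1.
Proof.
case: F G => [a b ab] [c d cd] /=; move: ab cd; rewrite !normCK => ab cd.
rewrite !rmorphD !rmorphM /= !conjCK.
transitivity ((a * a^* - b * b^*) * (c * c^* - d * d^*)); last by rewrite ab cd mulr1.
ring.
Qed.

Lemma mob_inv_axiom (R : realType) (F : disc_mobius R) :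
  `|(mob_alpha F)^*| ^+ 2 - `|- mob_beta F| ^+ 2 = 1.
Proof. by rewrite norm_conjC normrN mob_axiom. Qed.

(* Products and inverses of the matrices [alpha, beta; beta^*, alpha^*]; see
   mob_compE and mob_invK below. *)
Definition mob_id (R : realType) : disc_mobius R :=
  DiscMobius (mob_id_axiom R).

Definition mob_comp (R : realType) (F G : disc_mobius R) : disc_mobius R :=
  DiscMobius (mob_comp_axiom F G).

Definition mob_inv (R : realType) (F : disc_mobius R) : disc_mobius R :=
  DiscMobius (mob_inv_axiom F).

Lemma mob_den_neq0 (R : realType) (F : disc_mobius R) (z : C R) :
  circle R z -> (mob_beta F)^* * z + (mob_alpha F)^* != 0.
Proof.
case: F => [a b ab] /= z1; rewrite /circle /= in z1.
apply/eqP => /eqP; rewrite addr_eq0 => /eqP /(congr1 Num.norm).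
rewrite normrM z1 mulr1 normrN !norm_conjC => e.
by move: ab; rewrite e subrr => /esym/eqP; rewrite oner_eq0.
Qed.

Lemma mob_circle (R : realType) (F : disc_mobius R) (z : C R) :
  circle R z -> circle R (F z).
Proof.
move=> z1; have d0 := mob_den_neq0 F z1; move: z1 d0.
case: F => [a b ab]; rewrite /circle /mob_fun /= => z1 d0.
have zz : z * z^* = 1 by rewrite -normCK z1 expr1n.
have -> : a * z + b = z * (b^* * z + a^*)^*.
  by rewrite !rmorphD !rmorphM /= !conjCK mulrDr mulrCA zz mulr1 addrC mulrC.
by rewrite normf_div normrM z1 mul1r norm_conjC divff // normr_eq0.
Qed.

Lemma mob_idE (R : realType) (z : C R) : mob_id R z = z.
Proof. by rewrite /mob_fun /= rmorph0 rmorph1 mul1r mul0r add0r addr0 divr1. Qed.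

Lemma mob_compE (R : realType) (F G : disc_mobius R) (z : C R) :
  circle R z -> mob_comp F G z = F (G z).
Proof.
move=> z1; have := mob_den_neq0 (mob_comp F G) z1.
have := mob_den_neq0 F (mob_circle G z1); have := mob_den_neq0 G z1.
case: F G => [a b ab] [c d cd]; rewrite /mob_fun /=.
rewrite !rmorphD !rmorphM /= !conjCK => g0 f0 h0.
move: g0 f0 h0; move: (a^*) (b^*) (c^*) (d^*) => a' b' c' d' g0 f0 h0.
field; rewrite g0 /=; apply: contraNneq h0 => <-.
by apply/eqP; ring.
Qed.

Lemma mob_invK (R : realType) (F : disc_mobius R) (z : C R) :
  circle R z -> mob_inv F (F z) = z.
Proof.
move=> z1; rewrite -mob_compE //; case: F => [a b ab].
rewrite /mob_fun /=; move: ab; rewrite !normCK => ab.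
have -> : a^* * a + - b * b^* = 1 by rewrite -ab; ring.
have -> : a^* * b + - b * a^* = 0 by ring.
by rewrite rmorph0 rmorph1 mul1r mul0r add0r addr0 divr1.
Qed.

(* The uniform probability measure on the circle, as a Borel measure on the
   complex plane. *)
Definition borelC (R : realType) := g_sigma_algebraType (@open (C R)).

Definition circle_unif (R : realType) : set (borelC R) -> \bar R :=
  pushforward (uniform_prob (mulr_gt0 (ltr0n R 2) (pi_gt0 R)))
    (@expi R : R -> borelC R).

Definition mob_image (R : realType) (G : disc_mobius R)
    (mu : set (borelC R) -> \bar R) : set (borelC R) -> \bar R :=
  pushforward mu (G : borelC R -> borelC R).

(* Weak* convergence is tested against continuous functions on the circle; all
   the measures involved are concentrated there. *)
Definition represents (R : realType) (G : nat -> disc_mobius R) (x : C R) :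
    Prop :=
  circle R x /\
  forall f : C R -> R, {within circle R, continuous f} ->
    (\int[mob_image (G n) (@circle_unif R)]_(z in circle R) (f z)%:E)%E
      @[n --> \oo] -->
    (\int[\d_ (x : borelC R)]_(z in circle R) (f z)%:E)%E.

Definition expansion_interval (R : realType) (G : disc_mobius R) : set (C R) :=
  [set x | circle R x /\ 1 < `|derive1 (G : C R -> C R) x|].

Definition infword (A : finType) : topologicalType :=
  prod_topology (fun _ : nat => discrete_topology A).

Definition wprefix (A : finType) (w : infword A) (n : nat) : seq A := mkseq w n.

Definition cylinder (A : finType) (v : seq A) : set (infword A) :=
  [set w | wprefix w (size v) = v].

Definition wshift (A : finType) (w : infword A) : infword A :=
  fun i => w i.+1.

Definition subshift (A : finType) (S : set (infword A)) : Prop :=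
  closed S /\ @wshift A @` S `<=` S.

Definition language (A : finType) (S : set (infword A)) : set (seq A) :=
  [set v | exists w k, S w /\ v = mkseq (fun i => w (k + i)%N) (size v)].

Definition word_mob (R : realType) (A : finType) (F : A -> disc_mobius R)
    (v : seq A) : disc_mobius R :=
  foldr (fun a G => mob_comp (F a) G) (mob_id R) v.

Lemma word_mobE (R : realType) (A : finType) (F : A -> disc_mobius R)
    (v : seq A) (z : C R) :
  circle R z -> word_mob F v z = foldr (fun a y => F a y) z v.
Proof.
move=> z1; elim: v => [|a v IHv] /=; first exact: mob_idE.
by rewrite mob_compE // IHv.
Qed.

(* Partial function: the value 1 is junk when no point is represented. *)
Definition Phi (R : realType) (A : finType) (F : A -> disc_mobius R)
    (w : infword A) : C R :=
  xget 1 [set x | represents (fun n => word_mob F (wprefix w n.+1)) x].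

Definition Phi_defined (R : realType) (A : finType) (F : A -> disc_mobius R)
    (w : infword A) : Prop :=
  exists x, represents (fun n => word_mob F (wprefix w n.+1)) x.

Definition mobius_number_system (R : realType) (A : finType)
    (F : A -> disc_mobius R) (S : set (infword A)) : Prop :=
  [/\ subshift S,
      forall w, S w -> Phi_defined F w,
      Phi F @` S = circle R &
      {within S, continuous (Phi F)}].

(* Depending on t - s this is empty, an arc, the circle minus a point or the
   whole circle, i.e. exactly the open connected subsets of the circle. *)
Definition open_arc (R : realType) (s t : R) : set (C R) :=
  @expi R @` `]s, t[.

(* The circle is closed, so closures in the plane and in the circle agree. *)
Definition interval_almost_cover (R : realType) (A : finType)
    (W : A -> set (C R)) : Prop :=
  (forall a, exists I : seq (R * R),
     W a = \bigcup_(p in [set` I]) open_arc p.1 p.2) /\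
  \bigcup_a closure (W a) = circle R.

Definition refined (R : realType) (A : finType) (F : A -> disc_mobius R)
    (W : A -> set (C R)) (u : seq A) : set (C R) :=
  [set x | circle R x /\
    forall p a s, u = p ++ a :: s -> (word_mob F p @` W a) x].

Definition compatible (R : realType) (A : finType) (F : A -> disc_mobius R)
    (W : A -> set (C R)) (S : set (infword A)) : Prop :=
  [/\ subshift S, S !=set0 &
      forall v, language S v ->
        closure (refined F W v) =
        \bigcup_(a in [set a | language S (rcons v a)])
          closure (refined F W (rcons v a))].

Definition interval_shift (R : realType) (A : finType) (F : A -> disc_mobius R)
    (W : A -> set (C R)) (S : set (infword A)) : set (infword A) :=
  [set w | S w /\ forall n, refined F W (wprefix w n) !=set0].

(* Main.v *)
Require Import Defs.
From HB Require Import structures.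
From mathcomp Require Import all_boot all_order all_algebra.
From mathcomp Require Import all_classical all_reals all_analysis.
From mathcomp Require Import measurable_realfun complex ring lra.
Import Order.TTheory GRing.Theory Num.Theory numFieldNormedType.Exports.
Local Open Scope classical_set_scope.
Local Open Scope ring_scope.
Set Implicit Arguments.
Unset Strict Implicit.
Unset Printing Implicit Defensive.

(** A word [w] of the interval shift determines the decreasing sets
    [refined F W (wprefix w n)]; by compactness of the circle their closures
    have a common point [y].  The theorem follows once the maps
    [word_mob F (wprefix w n)] are known to represent every such [y]: there is
    then only one, it is [Phi F w], the nested sets shrink to it (hence [Phi] is
    continuous), and compatibility of the cover lets every point of the closure
    of [refined F W v] be followed along an infinite word that extends [v].

    Two facts reduce representation to a statement about numbers.  For
    [F = (alpha z + beta) / (beta^* z + alpha^* )] let [den F z] be the modulus of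
    the denominator, so that [F] stretches the circle at [z] by
    [(den F z) ^- 2].  The distance from [y] to [F 0] is
    [den (mob_inv F) y / |alpha|] (lemma [mob_center_dist]), and maps represent
    [y] as soon as their values at [0] tend to [y], because they send all of the
    circle but a short arc near the image of [0]
    ([represents_of_centers]).

    Cut [w] into words of [B].  The inverse maps of these words form a sequence
    [g k] from a finite family; along the orbit [y_k] of [y] they satisfy
    [den (g k) y_k <= 1], since [y] is a limit of points that are strictly
    expanded.  The products [P_k] of these numbers are the factors
    [den (mob_inv F) y] of the whole composition.

    If [P_k] tends to [0], the centres converge.  If not, the numbers
    [den (g k) y_k] tend to [1] and the orbit approaches the finitely many points
    where one of the maps is infinitesimally an isometry; as the maps do not
    contract towards such points, the orbit eventually consists of them
    ([eventually_isometric]).  From then on, in the coordinate [cot (t / 2)] on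
    the circle minus the current point, each map is a translation.  The expanded
    points near [y] stay on one side of the orbit, which forces all translations
    to have the same sign; their sum grows linearly, it is [|beta|] for the
    composed map, and so [|alpha|] tends to infinity ([isometric_growth]). *)

(** * Real-valued moduli and the algebra of disc-preserving maps *)

Section Modulus.
Variable R : realType.
Implicit Types (z x : C R) (r : R).

(** The norm of [C R] takes its values in [C R] itself; [mag] is the same
    number seen in [R], where the order is total. *)
Definition mag z : R := complex.Re `|z|.

Lemma magE z : ((mag z)%:C)%C = `|z|.
Proof. by rewrite /mag RRe_real // normr_real. Qed.

Lemma magM z x : mag (z * x) = mag z * mag x.
Proof. by apply: complexI; rewrite rmorphM /= !magE normrM. Qed.

Lemma mag1 : mag (1 : C R) = 1.
Proof. by apply: complexI; rewrite magE normr1. Qed.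

Lemma mag_conj z : mag z^* = mag z.
Proof. by apply: complexI; rewrite !magE norm_conjC. Qed.

Lemma magN z : mag (- z) = mag z.
Proof. by rewrite /mag normrN. Qed.

Lemma mag_ge0 z : 0 <= mag z.
Proof. by rewrite -lecR magE rmorph0. Qed.

Lemma mag_eq0 z : (mag z == 0) = (z == 0).
Proof. by rewrite -(fmorph_eq0 (real_complex R)) /= magE normr_eq0. Qed.

Lemma mag0 : mag (0 : C R) = 0.
Proof. by apply/eqP; rewrite mag_eq0. Qed.

Lemma magD z x : mag (z + x) <= mag z + mag x.
Proof. by rewrite -lecR rmorphD /= !magE ler_normD. Qed.

Lemma magB z x : mag (z - x) = mag (x - z).
Proof. by rewrite -magN opprB. Qed.

Lemma mag_sub_ge z x : mag z - mag x <= mag (z - x).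
Proof. by rewrite lerBlDr; apply: le_trans (magD _ _); rewrite subrK. Qed.

Lemma magV z : mag z^-1 = (mag z)^-1.
Proof. by apply: complexI; rewrite fmorphV /= !magE normfV. Qed.

Lemma mag_div z x : mag (z / x) = mag z / mag x.
Proof. by rewrite magM magV. Qed.

Lemma circleP z : circle R z <-> mag z = 1.
Proof.
rewrite /circle /= -magE; split=> [h|->]; last by rewrite rmorph1.
by apply: complexI; rewrite h rmorph1.
Qed.

Lemma circle_neq0 z : circle R z -> z != 0.
Proof. by move=> /circleP h; rewrite -mag_eq0 h oner_eq0. Qed.

Lemma circle_conj z : circle R z -> z * z^* = 1.
Proof. by move=> h; rewrite -normCK h expr1n. Qed.

Lemma mag_real r : mag ((r%:C)%C : C R) = `|r|.
Proof.
by apply: complexI; rewrite magE normc_def /= expr0n addr0 sqrtr_sqr.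
Qed.

Lemma mag_sqr z : mag z ^+ 2 = complex.Re z ^+ 2 + complex.Im z ^+ 2.
Proof. by apply: complexI; rewrite rmorphXn /= magE add_Re2_Im2. Qed.

Lemma ball_mag z (e : C R) x : 0 < e -> ball z e x = (mag (z - x) < complex.Re e) :> Prop.
Proof.
move=> e0; have er : e = ((complex.Re e)%:C)%C by rewrite RRe_real ?gtr0_real.
by rewrite -ball_normE /ball_ /= -magE er ltcR /=.
Qed.

End Modulus.

Section MobiusAlgebra.
Variable R : realType.
Implicit Types (F G H : disc_mobius R) (z y : C R).

Lemma mob_ext F G :
  mob_alpha F = mob_alpha G -> mob_beta F = mob_beta G -> F = G.
Proof.
case: F G => [a b ab] [a' b' ab'] /= e e'; move: ab'; rewrite -e -e' => ab'.
by rewrite (eq_irrelevance ab ab').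
Qed.

Lemma mob_compA F G H : mob_comp F (mob_comp G H) = mob_comp (mob_comp F G) H.
Proof.
by apply: mob_ext; rewrite /= !rmorphD !rmorphM /= !conjCK; ring.
Qed.

Lemma mob_1comp F : mob_comp (mob_id R) F = F.
Proof. by apply: mob_ext; rewrite /=; ring. Qed.

Lemma mob_inv_comp F G : mob_inv (mob_comp F G) = mob_comp (mob_inv G) (mob_inv F).
Proof. by apply: mob_ext; rewrite /= ?(rmorphD, rmorphM, rmorphN) /= ?conjCK; ring. Qed.

Lemma mob_inv1 : mob_inv (mob_id R) = mob_id R.
Proof. by apply: mob_ext; rewrite /= ?conjC1 ?oppr0. Qed.

(** The modulus of the denominator of [F] at [z]: [(den F z) ^- 2] is the
    derivative of [F] along the circle, so [den] is the multiplicative cocycle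
    that records how compositions stretch. *)
Definition den F z : R := mag ((mob_beta F)^* * z + (mob_alpha F)^*).

Lemma den_gt0 F z : circle R z -> 0 < den F z.
Proof. by move=> h; rewrite lt0r mag_ge0 mag_eq0 mob_den_neq0. Qed.

Lemma den_id z : den (mob_id R) z = 1.
Proof. by rewrite /den /= rmorph0 rmorph1 mul0r add0r mag1. Qed.

Lemma den_comp F G z : circle R z ->
  den (mob_comp F G) z = den F (G z) * den G z.
Proof.
move=> h; rewrite /den -magM; congr mag.
have := mob_den_neq0 G h; case: F G => [a b ab] [c d cd]; rewrite /mob_fun /=.
rewrite !rmorphD !rmorphM /= !conjCK => n0.
by field.
Qed.

Lemma mob_dist F z y : circle R z -> circle R y ->
  mag (F z - F y) * (den F z * den F y) = mag (z - y).
Proof.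
move=> hz hy; rewrite /den -!magM; congr mag.
have := mob_den_neq0 F hz; have := mob_den_neq0 F hy.
case: F => [a b ab]; rewrite /mob_fun /= => n0 n1.
have e : a * a^* - b * b^* = 1 by rewrite -!normCK ab.
rewrite -[RHS]mulr1 -e; field; by rewrite n0 n1.
Qed.

Lemma mag_alpha_sqr F : mag (mob_alpha F) ^+ 2 = 1 + mag (mob_beta F) ^+ 2.
Proof.
apply: complexI; rewrite rmorphD !rmorphXn rmorph1 /= !magE.
by rewrite -(mob_axiom F) subrK.
Qed.

Lemma mag_alpha_ge1 F : 1 <= mag (mob_alpha F).
Proof.
have h := mag_alpha_sqr F; have := sqr_ge0 (mag (mob_beta F)).
have := mag_ge0 (mob_alpha F); nra.
Qed.

Lemma mag_alpha_gt0 F : 0 < mag (mob_alpha F).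
Proof. exact: lt_le_trans ltr01 (mag_alpha_ge1 F). Qed.

Lemma mag_beta_lt F : mag (mob_beta F) < mag (mob_alpha F).
Proof.
have h := mag_alpha_sqr F; have := mag_ge0 (mob_beta F).
have := mag_alpha_ge1 F; nra.
Qed.

Lemma den_le F z : circle R z -> den F z <= mag (mob_alpha F) + mag (mob_beta F).
Proof.
move=> /circleP h; apply: le_trans (magD _ _) _.
by rewrite magM h mulr1 !mag_conj addrC.
Qed.

Lemma den_ge F z : circle R z -> mag (mob_alpha F) - mag (mob_beta F) <= den F z.
Proof.
move=> /circleP h; rewrite /den [_ * z + _]addrC -[_ * z]opprK.
by apply: le_trans (mag_sub_ge _ _); rewrite magN magM h mulr1 !mag_conj.
Qed.

Lemma den_conjM F z : circle R z ->
  (((den F z ^+ 2)%:C)%C : C R) =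
  1 + mob_beta F * (mob_beta F)^* *+ 2 +
  (mob_alpha F * (mob_beta F)^* * z + (mob_alpha F * (mob_beta F)^* * z)^*).
Proof.
move=> h; have zz := circle_conj h; have ab := mob_axiom F.
rewrite rmorphXn /= magE normCK -{1}ab; move: ab; rewrite !normCK => ab.
rewrite !(rmorphD, rmorphM) /= !conjCK.
transitivity (mob_beta F * (mob_beta F)^* * (z * z^*) +
  mob_alpha F * (mob_alpha F)^* + mob_alpha F * (mob_beta F)^* * z +
  (mob_alpha F)^* * mob_beta F * z^*); first by ring.
rewrite zz; ring.
Qed.

(** This turns the convergence of the images of the centre into estimates on
    the cocycle [den] and on the size of [alpha]. *)
Lemma mob_center_dist F z : circle R z ->
  mag (z - F 0) * mag (mob_alpha F) = den (mob_inv F) z.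
Proof.
move=> h; have a0 : (mob_alpha F)^* != 0.
  by rewrite conjC_eq0 -mag_eq0 gt_eqF ?mag_alpha_gt0.
rewrite /den /= -[in LHS](mag_conj (mob_alpha F)) -magM -[RHS]mag_conj -[RHS]mul1r.
move/circleP : (h) => h1; rewrite -[X in _ = X * _]h1 -magM; congr mag.
rewrite !(rmorphD, rmorphM, rmorphN) /= !conjCK /mob_fun mulr0 add0r mulr0 add0r.
transitivity (z * (mob_alpha F)^* - mob_beta F * (z * z^*)); last by ring.
rewrite circle_conj //; by field.
Qed.

Lemma mag_alpha_comp F G :
  mag (mob_alpha F) <= mag (mob_alpha (mob_comp F G)) * (mag (mob_alpha G) *+ 2).
Proof.
have h : mag (mob_alpha F) * mag (mob_alpha G) -
         mag (mob_beta F) * mag (mob_beta G) <= mag (mob_alpha (mob_comp F G)).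
  rewrite /= -[_ * (mob_beta G)^*]opprK.
  apply: le_trans (mag_sub_ge _ _).
  by rewrite magN !magM mag_conj.
have := mag_alpha_sqr G; have := mag_beta_lt F; have := mag_beta_lt G.
have := mag_ge0 (mob_beta F); have := mag_ge0 (mob_beta G).
set a := mag (mob_alpha F) in h *; set c := mag (mob_alpha G) in h *.
set b := mag (mob_beta F) in h *; set d := mag (mob_beta G) in h *.
set e := mag (mob_alpha (mob_comp F G)) in h *.
move=> d0 b0 dc ba cd.
have h1 : a * (c - d) <= e by nra.
have -> : a = (a * (c - d)) * (c + d) by rewrite -mulrA -subr_sqr cd addrK mulr1.
apply: ler_pM => //; nra.
Qed.

End MobiusAlgebra.

(** * Boundary points where a map is infinitesimally an isometry *)

Section CriticalPoints.
Variable R : realType.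
Implicit Types (F G : disc_mobius R) (z y : C R).

(** The two points of the circle where [den F] equals [1], for [F] not a
    rotation: with [q = alpha beta^* z] the equation reads
    [Re q = - |beta| ^ 2], and [|q| = |alpha| |beta|] leaves
    [Im q = |beta|] or [Im q = - |beta|]. *)
Definition crit F (s : bool) : C R :=
  (- (mob_beta F * (mob_beta F)^*) + (-1) ^+ s * 'i * `|mob_beta F|) /
  (mob_alpha F * (mob_beta F)^*).

(** With [q = alpha beta^* z], multiplying the two differences by
    [(alpha beta^* ) ^ 2] gives [(q + |beta| ^ 2) ^ 2 + |beta| ^ 2], which is
    [q (q + q^* + 2 |beta| ^ 2) = q (den F z ^ 2 - 1)]. *)
Lemma crit_product F z : mob_beta F != 0 -> circle R z ->
  mag (z - crit F true) * mag (z - crit F false) *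
    (mag (mob_alpha F) * mag (mob_beta F)) = `|den F z ^+ 2 - 1|.
Proof.
move=> b0 hz; rewrite -mag_real rmorphB rmorph1 /= den_conjM //.
have a0 : mob_alpha F != 0 by rewrite -mag_eq0 gt_eqF ?mag_alpha_gt0.
have bc0 : (mob_beta F)^* != 0 by rewrite conjC_eq0.
have q0 : mag (mob_alpha F * (mob_beta F)^* * z) =
    mag (mob_alpha F) * mag (mob_beta F).
  by rewrite !magM mag_conj; move/circleP: hz => ->; rewrite mulr1.
have p0 : mag (mob_alpha F) * mag (mob_beta F) != 0.
  by rewrite mulf_neq0 // mag_eq0.
apply: (mulIf p0); rewrite -[in RHS]q0 -(mag_conj (mob_beta F)) -!magM.
congr mag; have n2 : `|mob_beta F| ^+ 2 = mob_beta F * (mob_beta F)^* by rewrite normCK.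
have i2 : ('i : C R) ^+ 2 = -1 by rewrite sqrCi.
have aa : mob_alpha F * (mob_alpha F)^* = 1 + mob_beta F * (mob_beta F)^*.
  by rewrite -!normCK -(mob_axiom F) subrK.
have zz := circle_conj hz.
rewrite /crit expr1 expr0.
transitivity ((mob_alpha F * (mob_beta F)^* * z + mob_beta F * (mob_beta F)^*) ^+ 2
  - 'i ^+ 2 * `|mob_beta F| ^+ 2).
  by field; rewrite a0 bc0.
rewrite i2 n2 !rmorphM /= conjCK.
transitivity ((mob_alpha F * (mob_beta F)^* * z) ^+ 2 +
  mob_alpha F * (mob_beta F)^* * z * (mob_beta F * (mob_beta F)^*) *+ 2 +
  mob_beta F * (mob_beta F)^* * (1 + mob_beta F * (mob_beta F)^*)); first by ring.
rewrite -aa.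
transitivity ((mob_alpha F * (mob_beta F)^* * z) ^+ 2 +
  mob_alpha F * (mob_beta F)^* * z * (mob_beta F * (mob_beta F)^*) *+ 2 +
  mob_beta F * (mob_beta F)^* * (mob_alpha F * (mob_alpha F)^*) * (z * z^*)).
  by rewrite zz mulr1.
by ring.
Qed.

Lemma crit_circle F s : mob_beta F != 0 -> circle R (crit F s).
Proof.
move=> b0; apply/circleP; rewrite /crit mag_div magM mag_conj.
have p0 : 0 < mag (mob_alpha F) * mag (mob_beta F).
  by rewrite mulr_gt0 ?mag_alpha_gt0 // lt0r mag_eq0 b0 mag_ge0.
apply: (mulIf (lt0r_neq0 p0)); rewrite divfK ?lt0r_neq0 // mul1r.
apply/eqP; rewrite -(@eqrXn2 _ 2%N) // ?mag_ge0 ?ltW //; apply/eqP.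
rewrite exprMn mag_alpha_sqr; apply: complexI.
rewrite rmorphXn rmorphM rmorphD rmorph1 rmorphXn /= !magE !normCK.
rewrite !(rmorphD, rmorphM, rmorphN, rmorphXn, rmorph1) /= !conjCK conjCi conj_normC.
have i2 : ('i : C R) ^+ 2 = -1 by rewrite sqrCi.
have n2 : `|mob_beta F| ^+ 2 = mob_beta F * (mob_beta F)^* by rewrite normCK.
have s2 : ((-1) ^+ s : C R) ^+ 2 = 1 by rewrite sqrr_sign.
transitivity ((mob_beta F * (mob_beta F)^*) ^+ 2 -
  ((-1) ^+ s) ^+ 2 * 'i ^+ 2 * `|mob_beta F| ^+ 2); first by ring.
by rewrite s2 i2 n2; ring.
Qed.

Lemma den_crit F s : mob_beta F != 0 -> den F (crit F s) = 1.
Proof.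
move=> b0; have hc := crit_circle s b0; have := crit_product b0 hc.
have -> : mag (crit F s - crit F true) * mag (crit F s - crit F false) = 0.
  by case: s {hc}; rewrite subrr mag0 ?mul0r ?mulr0.
rewrite mul0r => /esym/eqP; rewrite normr_eq0 subr_eq0 => /eqP h.
by apply/eqP; rewrite -(@eqrXn2 _ 2%N) // ?mag_ge0 // expr1n h.
Qed.

Lemma near_crit F z : mob_beta F != 0 -> circle R z -> den F z <= 1 ->
  exists s, mag (z - crit F s) ^+ 2 * (mag (mob_alpha F) * mag (mob_beta F))
    <= (1 - den F z) *+ 2.
Proof.
move=> b0 hz d1; have := crit_product b0 hz.
have d0 := den_gt0 F hz.
have -> : `|den F z ^+ 2 - 1| = 1 - den F z ^+ 2 by rewrite ler0_norm ?opprB //; nra.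
have p0 : 0 < mag (mob_alpha F) * mag (mob_beta F).
  by rewrite mulr_gt0 ?mag_alpha_gt0 // lt0r mag_eq0 b0 mag_ge0.
have key (u v : R) : 0 <= u -> 0 <= v -> u <= v ->
    u * v * (mag (mob_alpha F) * mag (mob_beta F)) = 1 - den F z ^+ 2 ->
    u ^+ 2 * (mag (mob_alpha F) * mag (mob_beta F)) <= (1 - den F z) *+ 2.
  move=> u0 v0 uv e; apply: le_trans (_ : 1 - den F z ^+ 2 <= _); last by nra.
  by rewrite -e expr2 ler_pM2r // ler_wpM2l.
have [uv|vu] := leP (mag (z - crit F true)) (mag (z - crit F false)) => e.
- by exists true; apply: key uv e; exact: mag_ge0.
- exists false; apply: key (ltW vu) _; rewrite ?mag_ge0 // -e.
  by rewrite [mag _ * mag (z - _)]mulrC.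
Qed.

End CriticalPoints.

Section Orbits.
Variable R : realType.
Implicit Types (g : nat -> disc_mobius R) (y z : C R).

Fixpoint path_mob g (k : nat) : disc_mobius R :=
  if k is k'.+1 then mob_comp (g k') (path_mob g k') else mob_id R.

Lemma path_mobS g k z : circle R z -> path_mob g k.+1 z = g k (path_mob g k z).
Proof. by move=> h; rewrite /= mob_compE. Qed.

Lemma path_mobD g m k :
  path_mob g (m + k) = mob_comp (path_mob (fun j => g (m + j)%N) k) (path_mob g m).
Proof.
elim: k => [|k IH]; first by rewrite addn0 mob_1comp.
by rewrite addnS /= IH mob_compA.
Qed.

Lemma den_pathS g k z : circle R z ->
  den (path_mob g k.+1) z = den (g k) (path_mob g k z) * den (path_mob g k) z.
Proof. by move=> h; rewrite /= den_comp. Qed.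

Lemma finite_pos_lb (J : finType) (f : J -> R) :
  exists2 m : R, 0 < m & forall j, 0 < f j -> m <= f j.
Proof.
suff [m m0 h] : exists2 m, 0 < m & forall j, j \in enum J -> 0 < f j -> m <= f j.
  by exists m => // j; apply: h; rewrite mem_enum.
elim: (enum J) => [|j s [m m0 IH]]; first by exists 1.
exists (if 0 < f j then Num.min m (f j) else m).
  by case: ifP => // h; rewrite lt_min m0.
move=> x; rewrite inE => /orP[/eqP -> h|/IH h /h {}h].
  by rewrite h ge_min lexx orbT.
by case: ifP => // _; rewrite ge_min h.
Qed.

Lemma finite_ub (J : finType) (f : J -> R) :
  exists2 m : R, 0 < m & forall j, f j <= m.
Proof.
have [m m0 h] := finite_pos_lb (fun j => (Num.max 1 (f j))^-1).
exists m^-1 => [|j]; first by rewrite invr_gt0.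
have p : 0 < Num.max 1 (f j) by rewrite lt_max ltr01.
have := h j; rewrite invr_gt0 => /(_ p); rewrite -lef_pV2 ?posrE ?invr_gt0 // invrK.
by apply: le_trans; rewrite le_max lexx orbT.
Qed.

(** A bounded monotone sequence converges. *)
Lemma small_steps (u : nat -> R) (L e : R) : 0 < e ->
  (forall k, u k.+1 <= u k) -> (forall k, L <= u k) ->
  exists K, forall k, (K <= k)%N -> u k - u k.+1 < e.
Proof.
move=> e0 dec lb; pose E := range u.
have hE : has_inf E.
  by split; [exists (u 0%N); exists 0%N | exists L => _ [k _ <-]].
have [_ [K _ <-] hK] := inf_adherent e0 hE.
exists K => k Kk.
have : u k <= u K.
  by rewrite -(subnK Kk); elim: (k - K)%N => [|j IH] //; rewrite addSn (le_trans (dec _)).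
have : inf E <= u k.+1 by apply: ge_inf; [case: hE | exists k.+1].
by lra.
Qed.

(** If the stretching factors along the orbit of [y] are at most [1] while their
    products stay away from [0], the factors tend to [1], so the orbit
    approaches the critical points of the maps.  There are finitely many of
    these, hence the nearest ones are eventually mapped to one another; since
    the maps do not contract towards a critical point, the distance from the
    orbit to it cannot decrease, and it vanishes from some time on. *)
Lemma eventually_isometric (I : finType) (h : I -> disc_mobius R) (i : nat -> I)
    y (L : R) (g := fun k => h (i k)) :
  circle R y -> 0 < L ->
  (forall k, mob_beta (g k) != 0) ->
  (forall k, den (g k) (path_mob g k y) <= 1) ->
  (forall k, L <= den (path_mob g k) y) ->
  exists K, forall k, (K <= k)%N -> den (g k) (path_mob g k y) = 1.
Proof.
move=> hy L0 nb d1 Plb.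
pose x k := path_mob g k y.
have hx k : circle R (x k) by apply: mob_circle.
have d0 k : 0 < den (g k) (x k) by exact: den_gt0.
have [c c0 hc] := finite_pos_lb (fun j => mag (mob_alpha (h j)) * mag (mob_beta (h j))).
have cg k : c <= mag (mob_alpha (g k)) * mag (mob_beta (g k)).
  by apply: hc; rewrite mulr_gt0 ?mag_alpha_gt0 // lt0r mag_eq0 nb mag_ge0.
have [s hs] := choice (fun k => near_crit (nb k) (hx k) (d1 k)).
pose e k := crit (g k) (s k); pose r k := mag (x k - e k).
have he k : circle R (e k) by apply: crit_circle.
have r0 k : 0 <= r k by exact: mag_ge0.
(* [P_k - P_(k+1) = (1 - den) P_k] with [P_k >= L] bounds [1 - den], and then
   [near_crit] bounds the distance [r k] to a critical point. *)
have small (t : R) : 0 < t ->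
    exists K, forall k, (K <= k)%N -> r k < t /\ 1 - den (g k) (x k) < t.
  move=> t0; pose t' := Num.min (t * L) (c * t ^+ 2 / 2 * L).
  have t'0 : 0 < t' by rewrite lt_min !(mulr_gt0, exprn_gt0) ?invr_gt0.
  have dec k : den (path_mob g k.+1) y <= den (path_mob g k) y.
    by rewrite den_pathS // ler_piMl ?mag_ge0 // d1.
  have [K hK] := small_steps t'0 dec Plb.
  exists K => k /hK; rewrite den_pathS // -/(x k) lt_min => /andP[h1 h2].
  have := Plb k; have := hs k; have := cg k; rewrite -/(e k) -/(r k).
  have := d1 k; rewrite -/(x k); have := r0 k; have := d0 k.
  move: (mag _ * mag _) (den (path_mob g k) y) (den (g k) (x k)) h1 h2 (r k) => cc P d h1 h2 q.
  move=> dp q0 dl ccl hq PL.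
  have k1 : (1 - d) * L <= P - d * P by nra.
  have l1 : 1 - d < t by rewrite -(ltr_pM2r L0); lra.
  have l2 : 1 - d < c * t ^+ 2 / 2 by rewrite -(ltr_pM2r L0); lra.
  split=> //; rewrite ltNge; apply/negP => tq.
  have : c * t ^+ 2 <= q ^+ 2 * cc.
    rewrite mulrC; apply: ler_pM => //; [exact: sqr_ge0|exact: ltW|].
    by rewrite lerXn2r ?nnegrE // ltW.
  by move: hq l2; rewrite -mulr_natr; lra.
have step k : mag (x k.+1 - g k (e k)) * den (g k) (x k) = r k.
  rewrite /x path_mobS // -/(x k).
  have := mob_dist (g k) (hx k) (he k).
  by rewrite /e den_crit // mulr1.
(* [m] separates the finitely many possible positions of an image of a critical
   point from the critical points different from it. *)
have [m m0 hm] := finite_pos_lb (fun p : (I * bool) * (I * bool) =>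
  mag (h p.1.1 (crit (h p.1.1) p.1.2) - crit (h p.2.1) p.2.2)).
have [K hK] := small (Num.min (m / 4) (1 / 2)) (ltac:(rewrite lt_min; apply/andP; split; lra)).
have ge k : (K <= k)%N -> g k (e k) = e k.+1.
  move=> Kk; apply/eqP; rewrite -subr_eq0 -mag_eq0; apply/negPn/negP => n0.
  have := hm ((i k, s k), (i k.+1, s k.+1)); rewrite /= -/(e k) -/(e k.+1).
  rewrite lt0r mag_ge0 n0 => /(_ isT).
  have [] := hK k Kk; have [] := hK k.+1 (leqW Kk); rewrite !lt_min.
  move=> /andP[a1 _] _ /andP[a2 _] /andP[_ a3]; apply/negP; rewrite -ltNge.
  apply: le_lt_trans (_ : mag (g k (e k) - x k.+1) + r k.+1 < m).
    by apply: le_trans (magD _ _); rewrite addrA subrK.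
  have := step k; rewrite magB; have := mag_ge0 (g k (e k) - x k.+1).
  by move: (mag _) (den _ _) a1 a2 a3 => M D; nra.
have mono k : (K <= k)%N -> r k <= r k.+1.
  move=> Kk; rewrite -step (ge _ Kk) -/(r _) ler_piMr //; exact: d1.
have zero k : (K <= k)%N -> r k = 0.
  move=> Kk; apply/eqP; rewrite eq_le r0 andbT leNgt; apply/negP => rp.
  have [K' hK'] := small _ rp.
  have := (hK' (k + K')%N (leq_addl _ _)).1; apply/negP; rewrite -leNgt.
  elim: K' {hK'} => [|j IH]; first by rewrite addn0.
  by rewrite addnS (le_trans IH) // mono // (leq_trans Kk) ?leq_addr.
exists K => k /zero /eqP; rewrite mag_eq0 subr_eq0 => /eqP xe.
by rewrite -/(x k) xe den_crit.
Qed.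

End Orbits.

(** * The images of the centre converge *)

Section Sides.
Variable R : realType.
Implicit Types (F G : disc_mobius R) (z y : C R).

(** For [z = y e^(i t)] this is [- cot (t / 2) / 2]: a coordinate on the circle
    minus [y] that goes to infinity at [y], with opposite signs on the two
    sides.  A map that is infinitesimally an isometry at [y] acts on these
    coordinates as a translation, by [shear]. *)
Definition side z y : R := complex.Im (1 / (z / y - 1)).

Definition shear G y : R :=
  complex.Im (mob_alpha G * (mob_beta G)^* * y).

(** In a coordinate with its pole at the distinguished point, a Moebius map is
    affine; the linear coefficient is the inverse of its derivative. *)
Lemma mobius_quotient G z y : circle R z -> circle R y -> z != y ->
  1 / (G z / G y - 1) =
  ((den G y ^+ 2)%:C)%C * (1 / (z / y - 1)) +
  (mob_beta G * (mob_beta G)^* + mob_alpha G * (mob_beta G)^* * y).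
Proof.
move=> hz hy zy.
have zy0 : z - y != 0 by rewrite subr_eq0.
have y0 := circle_neq0 hy.
have nz := mob_den_neq0 G hz; have ny := mob_den_neq0 G hy.
have ny' : mob_alpha G * y + mob_beta G != 0.
  have := circle_neq0 (mob_circle G hy); rewrite /mob_fun.
  by apply: contraNneq => ->; rewrite mul0r.
have yy := circle_conj hy; have ab := mob_axiom G.
rewrite /den rmorphXn /= magE normCK; rewrite !normCK in ab.
rewrite !(rmorphD, rmorphM) /= !conjCK.
have -> : y^* = y^-1 by apply: (mulfI y0); rewrite yy divff.
rewrite /mob_fun.
move: (mob_alpha G) ((mob_alpha G)^*) (mob_beta G) ((mob_beta G)^*) ab nz ny ny'.
move=> a a' b b' ab nz ny ny'.
have n3 : (a * z + b) * (b' * y + a') - (a * y + b) * (b' * z + a') != 0.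
  have -> : (a * z + b) * (b' * y + a') - (a * y + b) * (b' * z + a') = z - y.
    by rewrite -[RHS]mul1r -ab; ring.
  by [].
have e1 : 1 / ((a * z + b) / (b' * z + a') / ((a * y + b) / (b' * y + a')) - 1) =
    (a * y + b) * (b' * z + a') / ((a * a' - b * b') * (z - y)).
  field; rewrite zy0 ab ny nz ny' oner_neq0 /=.
  by apply: contraNneq n3 => <-; apply/eqP; ring.
rewrite e1 ab; field; by rewrite y0 mulN1r zy0.
Qed.

Lemma isometric_re G y : circle R y -> den G y = 1 ->
  mob_beta G * (mob_beta G)^* + mob_alpha G * (mob_beta G)^* * y =
  Complex 0 (shear G y).
Proof.
move=> hy d1; have := den_conjM G hy; rewrite d1 expr1n rmorph1.
rewrite /shear; set q := _ * y; have -> : mob_beta G * (mob_beta G)^* =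
  ((mag (mob_beta G) ^+ 2)%:C)%C by rewrite rmorphXn /= magE normCK.
move: q (mag _ ^+ 2) => [u v] r /(congr1 (@complex.Re R)) /= h.
apply/eqP; rewrite eq_complex /= add0r eqxx andbT; apply/eqP.
lra.
Qed.

Lemma side_step G z y : circle R z -> circle R y -> z != y -> den G y = 1 ->
  side (G z) (G y) = side z y + shear G y.
Proof.
move=> hz hy zy d1; rewrite /side (mobius_quotient G hz hy zy).
rewrite isometric_re // d1 expr1n rmorph1 !mul1r.
by move: (_^-1) => [u v].
Qed.

Lemma re_side z y : circle R z -> circle R y -> z != y ->
  complex.Re (1 / (z / y - 1)) = - (1 / 2).
Proof.
move=> hz hy zy; have zy0 : z - y != 0 by rewrite subr_eq0.
have y0 := circle_neq0 hy; have z0 := circle_neq0 hz.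
have e : 1 / (z / y - 1) + (1 / (z / y - 1))^* = -1.
  rewrite !(rmorphM, rmorphB, fmorphV, rmorph1) /=.
  have -> : y^* = y^-1 by apply: (mulfI y0); rewrite circle_conj // divff.
  have -> : z^* = z^-1 by apply: (mulfI z0); rewrite circle_conj // divff.
  have yz0 : y - z != 0 by rewrite -opprB oppr_eq0.
  by field; rewrite !mulN1r zy0 yz0 z0 y0.
move: e; case: (1 / _) => u v /(congr1 (@complex.Re R)) /=; lra.
Qed.

Lemma side_sqr z y : circle R z -> circle R y -> z != y ->
  side z y ^+ 2 = (mag (z - y)) ^- 2 - 1 / 4.
Proof.
move=> hz hy zy; have y0 := circle_neq0 hy.
have := mag_sqr (1 / (z / y - 1)); rewrite re_side // -/(side z y) mag_div mag1.
have -> : mag (z / y - 1) = mag (z - y).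
  have -> : z / y - 1 = (z - y) / y by rewrite mulrBl divff.
  by rewrite mag_div; move/circleP: hy => ->; rewrite divr1.
have -> : (1 / mag (z - y)) ^+ 2 = mag (z - y) ^- 2.
  by rewrite expr_div_n expr1n div1r.
by move=> e; lra.
Qed.

(** Moving away from the distinguished point means that the coordinate
    decreases in absolute value, so the translation opposes its sign. *)
Lemma side_shear_lt0 G z y : circle R z -> circle R y -> den G y = 1 ->
  den G z < 1 -> side z y * shear G y < 0.
Proof.
move=> hz hy d1 dz.
have zy : z != y by apply: contraTneq dz => ->; rewrite d1 ltxx.
have gzy : G z != G y.
  by apply: contra_neq zy => e; rewrite -(mob_invK G hz) e mob_invK.
have := side_sqr (mob_circle G hz) (mob_circle G hy) gzy.
rewrite side_step // => e1; have e2 := side_sqr hz hy zy.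
have e3 := mob_dist G hz hy; rewrite d1 mulr1 in e3.
have m0 : 0 < mag (G z - G y) by rewrite lt0r mag_eq0 subr_eq0 gzy mag_ge0.
have : (mag (G z - G y)) ^- 2 < (mag (z - y)) ^- 2.
  rewrite -e3 ltf_pV2 ?posrE ?exprn_gt0 ?mulr_gt0 ?den_gt0 //.
  rewrite exprMn gtr_pMr ?exprn_gt0 // expr_lt1 // ltW // den_gt0 //.
have := sqr_ge0 (shear G y).
move: e1 e2; move: (_ ^- 2) (_ ^- 2) (side z y) (shear G y) => A B s t; nra.
Qed.

(** Here [alpha beta^* y] has modulus [|alpha| |beta|] and real part
    [- |beta| ^ 2]. *)
Lemma shear_abs G y : circle R y -> den G y = 1 ->
  `|shear G y| = mag (mob_beta G).
Proof.
move=> hy d1; have := isometric_re hy d1.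
have := mag_sqr (mob_alpha G * (mob_beta G)^* * y); rewrite -/(shear G y).
rewrite !magM mag_conj (circleP y).1 // mulr1 exprMn mag_alpha_sqr.
have -> : mob_beta G * (mob_beta G)^* =
  ((mag (mob_beta G) ^+ 2)%:C)%C by rewrite rmorphXn /= magE normCK.
case: (mob_alpha G * _ * y) => u v /= e.
move=> /(congr1 (@complex.Re R)) /= e'.
apply/eqP; rewrite -(@eqrXn2 _ 2%N) ?mag_ge0 // real_normK ?num_real //; apply/eqP.
move: e e'; move: (mag _) (shear _ _) => b s; nra.
Qed.

End Sides.

(** The position starts so far away that [k] steps cannot reach the origin: its
    sign does not change, and the steps all have the opposite sign and add
    up. *)
Lemma same_sign_drift (R : realType) (s t : nat -> R) (m M : R) (k : nat) :
  0 < m ->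
  (forall j, (j < k)%N -> s j.+1 = s j + t j) ->
  (forall j, (j < k)%N -> s j * t j < 0) ->
  (forall j, (j < k)%N -> m <= `|t j| <= M) ->
  k%:R * M < `|s 0%N| ->
  k%:R * m <= `|s k - s 0%N|.
Proof.
move=> m0; wlog s0 : s t / 0 < s 0%N.
  move=> wl h1 h2 h3 h4; have [s0|s0|s0] := ltgtP 0 (s 0%N).
  - exact: (wl s t).
  - have := wl (fun j => - s j) (fun j => - t j).
    rewrite oppr_gt0 s0 !normrN => /(_ isT).
    have -> : - s k - - s 0%N = - (s k - s 0%N) by ring.
    rewrite normrN.
    apply => // j jk; rewrite ?h1 ?opprD ?mulrNN ?normrN //; [exact: h2|exact: h3].
  - move: h4; rewrite -s0 normr0 subr0.
    have [->|k0] := posnP k; first by rewrite !mul0r normr_ge0.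
    by have := h2 0%N k0; rewrite -s0 mul0r ltxx.
move=> h1 h2 h3; rewrite gtr0_norm // => h4.
have [->|k0] := eqVneq k 0%N; first by rewrite mul0r normr_ge0.
have M0 : 0 < M by have := h3 0%N; rewrite lt0n k0 => /(_ isT) /andP[? ?]; lra.
have key j : (j <= k)%N -> s 0%N - j%:R * M <= s j <= s 0%N - j%:R * m.
  elim: j => [|j IH] jk; first by rewrite !mul0r subr0 lexx.
  have := IH (ltnW jk); have := h1 j jk; have := h2 j jk; have := h3 j jk.
  have : j%:R * M <= k%:R * M by rewrite ler_pM2r // ler_nat ltnW.
  rewrite -natr1 !mulrDl !mul1r; move: (j%:R * M) (j%:R * m) => jM jm l1.
  move=> /andP[a1 a2] b c /andP[d1 d2].
  have sj : 0 < s j by lra.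
  have tj : t j < 0 by rewrite -(pmulr_rlt0 _ sj).
  by move: a1 a2; rewrite ltr0_norm // => a1 a2; apply/andP; split; lra.
have /andP[_ le] := key k (leqnn k).
by rewrite ler_normr; apply/orP; right; rewrite opprB; lra.
Qed.

Section Centers.
Variable R : realType.
Implicit Types (g : nat -> disc_mobius R) (y z : C R).

Lemma mob_lipschitz (G : disc_mobius R) z y : circle R z -> circle R y ->
  mag (G z - G y) * (mag (mob_alpha G) - mag (mob_beta G)) ^+ 2 <= mag (z - y).
Proof.
move=> hz hy; rewrite -(mob_dist G hz hy) ler_wpM2l ?mag_ge0 // expr2.
by apply: ler_pM; rewrite ?den_ge // subr_ge0 ltW // mag_beta_lt.
Qed.

Lemma den_lipschitz (G : disc_mobius R) z y :
  den G y <= den G z + mag (mob_beta G) * mag (z - y).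
Proof.
rewrite -[mag (mob_beta G)]mag_conj -magM -magN /den.
apply: le_trans (magD _ _); rewrite le_eqVlt; apply/orP; left; apply/eqP.
by congr mag; ring.
Qed.

(** A point in the closures of the refined sets need not be expanded along its
    orbit; it is only a limit of points that are.  Being such a limit on the
    orbit is stronger than the inequality [den (g k) (path_mob g k y) <= 1]: it
    also singles out a side of the orbit. *)
Definition expansively_approached g y : Prop :=
  forall (k : nat) (e : R), 0 < e -> exists z,
    [/\ circle R z, mag (z - y) < e &
        forall j, (j < k)%N -> den (g j) (path_mob g j z) < 1].

Lemma approached_shift g y m : circle R y -> expansively_approached g y ->
  expansively_approached (fun j => g (m + j)%N) (path_mob g m y).
Proof.
move=> hy app k e e0.
pose d := mag (mob_alpha (path_mob g m)) - mag (mob_beta (path_mob g m)).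
have d0 : 0 < d by rewrite subr_gt0 mag_beta_lt.
have [|z [hz zy hd]] := app (m + k)%N (e * d ^+ 2).
  by rewrite mulr_gt0 // exprn_gt0.
exists (path_mob g m z); split=> [||j jk]; first exact: mob_circle.
- rewrite -(ltr_pM2r (exprn_gt0 2 d0)); apply: le_lt_trans zy.
  exact: mob_lipschitz.
- by rewrite -mob_compE // -path_mobD hd // ltn_add2l.
Qed.

Lemma approached_den g y k : circle R y -> expansively_approached g y ->
  den (g k) (path_mob g k y) <= 1.
Proof.
move=> hy app; rewrite leNgt; apply/negP => h.
have hy' := mob_circle (path_mob g k) hy.
have := approached_shift k hy app.
pose e := (den (g k) (path_mob g k y) - 1) / (1 + mag (mob_beta (g k))).
have b0 := mag_ge0 (mob_beta (g k)).
have e0 : 0 < e by rewrite divr_gt0 //; lra.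
move=> /(_ 1%N e e0) [z [hz zy /(_ 0%N isT)]]; rewrite addn0 /= mob_idE => dz.
have := den_lipschitz (g k) z (path_mob g k y).
have : mag (mob_beta (g k)) * mag (z - path_mob g k y) <= (1 + mag (mob_beta (g k))) * e.
  by apply: ler_pM => //; [exact: mag_ge0 | lra | exact: ltW].
by rewrite [(1 + _) * e]mulrC divfK ?gt_eqF //; lra.
Qed.

Lemma approached_nonrotation g y k : circle R y -> expansively_approached g y ->
  mob_beta (g k) != 0.
Proof.
move=> hy /(_ k.+1 1 ltr01) [z [hz _ /(_ k (leqnn _)) h]].
apply: contraTneq h => b0; rewrite -leNgt.
apply: le_trans (den_ge (g k) (mob_circle _ hz)).
by rewrite b0 mag0 subr0 mag_alpha_ge1.
Qed.

(** When all the maps are isometric along the orbit of [y], the total shear is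
    the sum of the shears of the maps, which have the same sign because the
    nearby expanded points stay on the same side of the orbit. *)
Lemma isometric_growth (I : finType) (h : I -> disc_mobius R) (i : nat -> I)
    y (g := fun k => h (i k)) :
  circle R y -> expansively_approached g y ->
  (forall k, den (g k) (path_mob g k y) = 1) ->
  exists2 m : R, 0 < m & forall k, k%:R * m <= mag (mob_beta (path_mob g k)).
Proof.
move=> hy app d1.
have [m m0 hm] := finite_pos_lb (fun j => mag (mob_beta (h j))).
have [M M0 hM] := finite_ub (fun j => mag (mob_beta (h j))).
have dp k : den (path_mob g k) y = 1.
  by elim: k => [|k IH]; rewrite ?den_id // den_pathS // IH d1 mulr1.
exists m => // k; rewrite -(shear_abs hy (dp k)).
(* At distance less than [e] from [y] the coordinate exceeds [k * M], which
   bounds the sum of [k] translations. *)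
pose e := (1 + (k%:R * M) ^+ 2)^-1.
have e0 : 0 < e by rewrite invr_gt0 ltr_wpDr // sqr_ge0.
have e1 : e <= 1 by rewrite invf_le1 ?lerDl ?sqr_ge0 // ltr_wpDr // sqr_ge0.
have [z [hz zy hd]] := app k.+1 e e0.
have zny : z != y.
  apply: contraTneq (hd 0%N isT) => ->; have := d1 0%N => /= ->.
  by rewrite ltxx.
have nz j : path_mob g j z != path_mob g j y.
  by apply: contra_neq zny => q; rewrite -(mob_invK (path_mob g j) hz) q mob_invK.
have := side_step hz hy zny (dp k).
set s := fun j => side (path_mob g j z) (path_mob g j y).
have -> : side z y = s 0%N by rewrite /s !mob_idE.
rewrite -/(s k) => sk; have -> : shear (path_mob g k) y = s k - s 0%N by lra.
apply: (@same_sign_drift _ s (fun j => shear (g j) (path_mob g j y)) m M) => //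
  [j jk|j jk|j jk|].
- rewrite /s !path_mobS // side_step //; exact: mob_circle.
- by apply: side_shear_lt0 => //; [exact: mob_circle|exact: mob_circle|exact/hd/ltnW].
- rewrite shear_abs //; last exact: mob_circle.
  rewrite hm ?hM // lt0r mag_eq0 mag_ge0 andbT.
  exact: (approached_nonrotation _ hy app).
- have zy0 : 0 < mag (z - y) by rewrite lt0r mag_eq0 subr_eq0 zny mag_ge0.
  have sq : s 0%N ^+ 2 = mag (z - y) ^- 2 - 1 / 4 by rewrite /s !mob_idE side_sqr.
  have X0 : 0 <= k%:R * M by rewrite mulr_ge0 // ltW.
  have lb : 1 + (k%:R * M) ^+ 2 <= (mag (z - y))^-1.
    by rewrite -[_ + _]invrK lef_pV2 ?posrE // ltW.
  rewrite ltNge; apply/negP => le.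
  have : s 0%N ^+ 2 <= (k%:R * M) ^+ 2.
    by rewrite -(real_normK (num_real _)) lerXn2r ?nnegrE.
  move: sq lb; rewrite -exprVn; move: (mag _)^-1 (k%:R * M) X0 => q X X0; nra.
Qed.

(** Either the product of the stretching factors along the orbit of [y] tends to
    [0], or the orbit is eventually isometric and the maps grow. *)
Theorem centers_converge (I : finType) (h : I -> disc_mobius R) (i : nat -> I)
    y (g := fun k => h (i k)) :
  circle R y -> expansively_approached g y ->
  forall e : R, 0 < e -> exists K, forall k, (K <= k)%N ->
    den (path_mob g k) y < e * mag (mob_alpha (path_mob g k)).
Proof.
move=> hy app e e0.
have d1 k : den (g k) (path_mob g k y) <= 1 by apply: approached_den.
have dec k : den (path_mob g k.+1) y <= den (path_mob g k) y.
  by rewrite den_pathS // ler_piMl ?mag_ge0.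
have decD m k : den (path_mob g (m + k)) y <= den (path_mob g m) y.
  by elim: k => [|k IH]; rewrite ?addn0 // addnS (le_trans (dec _)).
have [[L L0 hL]|nL] :=
  pselect (exists2 L : R, 0 < L & forall k, L <= den (path_mob g k) y); last first.
  have [K hK] : exists K, den (path_mob g K) y < e.
    apply: contrapT => /forallNP hn; apply: nL; exists e => // k.
    by rewrite leNgt; apply/negP.
  exists K => k Kk; rewrite -(subnKC Kk); apply: le_lt_trans (decD _ _) _.
  by apply: lt_le_trans hK _; rewrite ler_peMr ?mag_alpha_ge1 // ltW.
have nb k : mob_beta (g k) != 0 by apply: (approached_nonrotation _ hy app).
have [K hK] := eventually_isometric hy L0 nb d1 hL.
have [|m m0 hm] := isometric_growth (h := h) (i := fun j => i (K + j)%N)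
  (mob_circle (path_mob g K) hy) (approached_shift K hy app).
  by move=> k; rewrite -mob_compE // -path_mobD hK // leq_addr.
pose A := mag (mob_alpha (path_mob g K)).
have A1 : 1 <= A by exact: mag_alpha_ge1.
pose N := Num.bound (A *+ 2 / (e * m)).
exists (K + N)%N => k Kk; have Kk' : (K <= k)%N by apply: leq_trans Kk; rewrite leq_addr.
rewrite -(subnKC Kk'); apply: le_lt_trans (decD 0%N _) _; rewrite den_id.
have Nk : (N <= k - K)%N by rewrite leq_subRL.
move: (k - K)%N Nk => l Nl; have := hm l.
have := mag_beta_lt (path_mob (fun j => h (i (K + j)%N)) l).
have := mag_alpha_comp (path_mob (fun j => g (K + j)%N) l) (path_mob g K).
rewrite -path_mobD -/A /g /= -/g; move: (mag _) (mag _) (mag _) => p q r pq qp rl.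
have Nb : A *+ 2 / (e * m) < l%:R.
  apply: lt_le_trans (_ : N%:R <= _); last by rewrite ler_nat.
  by apply: archi_boundP; rewrite divr_ge0 ?mulrn_wge0 ?mulr_ge0 ?ltW //; lra.
move: Nb; rewrite ltr_pdivrMr ?mulr_gt0 // => Nb.
have A2 : 0 < A *+ 2 by rewrite mulrn_wgt0 //; lra.
rewrite -(ltr_pM2r A2) mul1r; apply: lt_le_trans Nb _.
rewrite mulrCA -mulrA ler_pM2l //; lra.
Qed.

End Centers.

(** * Topology of the circle *)

Section CircleTopology.
Variable R : realType.
Implicit Types (G : disc_mobius R) (z y x : C R).

Lemma nbhs_magP y (U : set (C R)) :
  nbhs y U <-> exists2 e : R, 0 < e & forall z, mag (z - y) < e -> U z.
Proof.
split=> [/nbhs_ballP [e e0 h]|[e e0 h]].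
- have e0' : 0 < complex.Re e by move: (e0 : 0 < e); rewrite ltcE => /andP[].
  by exists (complex.Re e) => // z hz; apply: h; rewrite ball_mag // magB.
- apply/nbhs_ballP; exists ((e%:C)%C) => /=; first by rewrite ltcR.
  by move=> z; rewrite ball_mag ?ltcR //= magB; apply: h.
Qed.

Lemma closure_magP y (U : set (C R)) :
  closure U y <-> forall e : R, 0 < e -> exists2 z, U z & mag (z - y) < e.
Proof.
split=> [h e e0|h V /nbhs_magP [e e0 he]].
- have [|z [Uz hz]] := h [set z | mag (z - y) < e]; last by exists z.
  by apply/nbhs_magP; exists e.
- by have [z Uz hz] := h _ e0; exists z; split=> //; apply: he.
Qed.

Lemma expi_circle (t : R) : circle R (expi t).
Proof.
apply/circleP/eqP; rewrite -(@eqrXn2 _ 2%N) ?mag_ge0 // mag_sqr /= expr1n.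
by rewrite cos2Dsin2.
Qed.

Lemma circle_expi z : circle R z -> exists2 t : R, t \in `[- pi, pi] & z = expi t.
Proof.
move=> /circleP h; have := mag_sqr z; rewrite h expr1n; case: z h => u v /= _ e.
have u1 : -1 <= u <= 1 by apply/andP; split; have := sqr_ge0 v; nra.
have ui : u \in `[(-1), 1] by rewrite in_itv.
have a0 := acos_ge0 u1; have ap := acos_lepi u1.
have sq : Num.sqrt (1 - u ^+ 2) = `|v|.
  by rewrite e addrC addKr sqrtr_sqr.
have [v0|v0] := leP 0 v.
- exists (acos u).
    by rewrite in_itv /=; apply/andP; split => //; have := pi_gt0 R; lra.
  by rewrite /expi sin_acos // acosK // sq ger0_norm.
- exists (- acos u).
    by rewrite in_itv /=; apply/andP; split; have := pi_gt0 R; lra.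
  by rewrite /expi sinN cosN sin_acos // acosK // sq ltr0_norm // opprK.
Qed.

Lemma mag_le_ReIm z : mag z <= `|complex.Re z| + `|complex.Im z|.
Proof.
rewrite -(@ler_pXn2r _ 2%N) // ?nnegrE ?mag_ge0 ?addr_ge0 // mag_sqr sqrrD.
rewrite !real_normK ?num_real // -subr_ge0.
have -> : complex.Re z ^+ 2 + `|complex.Re z| * `|complex.Im z| *+ 2 + complex.Im z ^+ 2 -
  (complex.Re z ^+ 2 + complex.Im z ^+ 2) = `|complex.Re z| * `|complex.Im z| *+ 2 by ring.
by rewrite mulrn_wge0 // mulr_ge0.
Qed.

Lemma continuous_expi : continuous (@expi R : R -> C R).
Proof.
move=> t U /nbhs_magP [e e0 h].
have e2 : 0 < e / 2 by lra.
have /cvgrPdist_lt/(_ _ e2) c1 := @continuous_cos R t.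
have /cvgrPdist_lt/(_ _ e2) c2 := @continuous_sin R t.
apply: filterS2 c1 c2 => s c1 c2; apply: h.
apply: le_lt_trans (mag_le_ReIm _) _.
by rewrite /= distrC [X in _ + X]distrC; lra.
Qed.

Lemma compact_circle : compact (circle R).
Proof.
have -> : circle R = @expi R @` `[- pi, pi]%classic.
  apply/seteqP; split=> [z /circle_expi [t ht ->]|_ [t _ <-]].
    by exists t.
  exact: expi_circle.
apply: continuous_compact; last exact: segment_compact.
exact/continuous_subspaceT/continuous_expi.
Qed.

Lemma nested_closures (U : nat -> set (C R)) :
  (forall n, U n `<=` circle R) -> (forall m n, (m <= n)%N -> U n `<=` U m) ->
  (forall n, U n !=set0) ->
  exists2 x, circle R x & forall n, closure (U n) x.
Proof.
move=> Uc Ud /choice [z hz].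
have [|x [hx cx]] := @compact_circle (z @ \oo) _.
  by exists 0%N => // n _; apply: Uc (hz n).
exists x => // n V Vx.
have [|w [/= Uw Vw]] := cx (U n) V _ Vx; last by exists w.
by exists n => // m /= nm; apply: Ud nm _ (hz m).
Qed.

Lemma nested_closures_shrink (U : nat -> set (C R)) y :
  (forall n, U n `<=` circle R) -> (forall m n, (m <= n)%N -> U n `<=` U m) ->
  (forall x, circle R x -> (forall n, closure (U n) x) -> x = y) ->
  forall e : R, 0 < e -> exists n, forall x, closure (U n) x -> mag (x - y) < e.
Proof.
move=> Uc Ud h e e0; apply: contrapT => /forallNP hn.
pose V n := U n `&` [set z | e / 2 <= mag (z - y)].
have [|||x hx cx] := @nested_closures V.
- by move=> n z [/Uc].
- by move=> m n mn z [/(Ud _ _ mn) ? ?]; split.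
- move=> n; have /existsNP [x /not_implyP [cx /negP]] := hn n; rewrite -leNgt => ex.
  have [|z Uz zx] := (closure_magP x (U n)).1 cx (e / 2); first by lra.
  exists z; split => //=; have := magD (x - z) (z - y); rewrite addrA subrK magB.
  lra.
have /h-/(_ hx) xy n : closure (U n) x.
  by apply: closureS (cx n) => z [].
have [|z [_ /= zy]] := (closure_magP x (V 0%N)).1 (cx 0%N) (e / 2); first by lra.
by rewrite xy; lra.
Qed.

Lemma closed_circle : closed (circle R).
Proof.
move=> x /closure_magP h; apply/circleP/eqP; rewrite eq_le.
apply/andP; split; rewrite leNgt; apply/negP => h1.
- have [|z /circleP hz] := h (mag x - 1); first by lra.
  by have := mag_sub_ge x z; rewrite magB; lra.
- have [|z /circleP hz] := h (1 - mag x); first by lra.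
  by have := mag_sub_ge z x; lra.
Qed.

Lemma mag_lipschitz x y z : `|mag (x - z) - mag (y - z)| <= mag (x - y).
Proof.
rewrite ler_norml; apply/andP; split.
- have := magD (y - x) (x - z); rewrite addrA subrK magB; lra.
- have := magD (x - y) (y - z); rewrite addrA subrK; lra.
Qed.

Lemma continuous_mag_sub y : continuous (fun z => mag (z - y) : R).
Proof.
move=> x U /= /nbhs_ballP [e e0 he]; apply/nbhs_magP; exists e => // z hz.
apply: he; rewrite -ball_normE /ball_ /=.
by apply: le_lt_trans (mag_lipschitz _ _ _) _; rewrite magB.
Qed.

Lemma continuous_mob G y : circle R y -> {for y, continuous (G : C R -> C R)}.
Proof.
move=> hy.
have c (a b : C R) : {for y, continuous (fun z => a * z + b)}.
  apply: (@continuousD _ (C R : normedModType (C R)) _ (fun z => a * z) (fun=> b)).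
    exact: mulrl_continuous.
  exact: cst_continuous.
apply: (@continuousM (C R) (C R)); first exact: c.
apply: continuousV; last exact: c.
exact: mob_den_neq0.
Qed.

Lemma derive1_mob G x : circle R x ->
  derive1 (G : C R -> C R) x =
  ((mob_beta G)^* * x + (mob_alpha G)^*) ^- 2.
Proof.
move=> hx; set c := fun z => (mob_beta G)^* * z + (mob_alpha G)^*.
have cx0 : c x != 0 by exact: mob_den_neq0.
apply/cvg_lim; first exact: norm_hausdorff.
have cc : {for (0 : C R), continuous (fun h => c (h + x))}.
  apply: (@continuousD _ (C R : normedModType (C R)) _
    (fun h => (mob_beta G)^* * (h + x)) (fun=> (mob_alpha G)^*)).
    apply: continuousM; first exact: cst_continuous.
    by apply: (@continuousD _ (C R : normedModType (C R)) _ id (fun=> x)) => //;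
      exact: cst_continuous.
  exact: cst_continuous.
have c0 : \forall h \near (0 : C R)^', c (h + x) != 0.
  apply: cvg_within; apply: (cc (fun w => w != 0)) => /=; rewrite add0r.
  apply/nbhs_magP; exists (mag (c x)); first by rewrite lt0r mag_eq0 cx0 mag_ge0.
  by move=> w; apply: contraTneq => ->; rewrite sub0r magN ltxx.
apply: cvg_trans (_ : (fun h => (c (h + x) * c x)^-1) @ 0^' --> _).
  apply: near_eq_cvg; near=> h.
  have h0 : h != 0 by near: h; exact: nbhs_dnbhs_neq.
  have ch : c (h + x) != 0 by near: h.
  have ab := mob_axiom G; rewrite !normCK in ab.
  have -> : h^-1 *: (G (h + x) - G x) = h^-1 * (G (h + x) - G x) by [].
  rewrite /mob_fun -/(c x) -/(c (h + x)).
  move: cx0 ch; rewrite /c => cx0 ch.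
  rewrite -[LHS]mul1r -[in LHS]ab; field.
  by rewrite h0 cx0 ch.
apply: cvg_within_filter.
have cM : {for (0 : C R), continuous (fun h => c (h + x) * c x)}.
  apply: continuousM; [exact: cc | exact: cst_continuous].
have n0 : c (0 + x) * c x != 0 by rewrite add0r mulf_neq0.
have := @continuousV (C R) (C R) (fun h => c (h + x) * c x) 0 n0 cM.
by rewrite /prop_for /continuous_at /= add0r -expr2.
Unshelve. all: by end_near.
Qed.

Lemma expansion_den G x :
  expansion_interval G x -> den G x < 1.
Proof.
move=> [hx]; rewrite derive1_mob // normfV normrX.
have d0 := den_gt0 G hx; rewrite -magE -/(den G x).
rewrite -rmorphXn -fmorphV -(rmorph1 (real_complex R)) ltcR => h.
rewrite ltNge; apply/negP => h1; move: h; apply/negP; rewrite -leNgt.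
by rewrite invf_le1 ?exprn_gt0 // expr_ge1 // ltW.
Qed.

End CircleTopology.

(** * Maps whose centres converge represent the limit *)

Section ConcentrationIntegral.
Context d (T : measurableType d) (R : realType).
Local Open Scope ereal_scope.

Lemma integral_close (mu : {measure set T -> \bar R}) (D E : set T) (f : T -> R)
    (c e M : R) :
  measurable D -> measurable E -> mu D = 1 -> measurable_fun D f ->
  (0 <= e)%R -> (0 <= M)%R ->
  (forall z, D z -> (`|f z - c| <= M)%R) ->
  (forall z, D z -> ~ E z -> (`|f z - c| <= e)%R) ->
  `| \int[mu]_(z in D) (f z)%:E - c%:E | <= e%:E + M%:E * mu E.
Proof.
move=> mD mE D1 mf e0 M0 fM fe.
have Dfin : mu D < +oo by rewrite D1 ltry.
have intf : mu.-integrable D (EFin \o f).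
  apply: measurable_bounded_integrable => //.
  exists (M + `|c|)%R; split; first by rewrite num_real.
  move=> x Mx z Dz /=; apply: le_trans (ltW Mx).
  by rewrite -(subrK c (f z)) (le_trans (ler_normD _ _)) // lerD2r fM.
have intc : mu.-integrable D (EFin \o cst c).
  apply: measurable_bounded_integrable => //.
  exists `|c|%R; split; first by rewrite num_real.
  by move=> x cx z _ /=; exact: ltW.
have -> : c%:E = \int[mu]_(z in D) (cst c z)%:E.
  have := integral_cst mu mD c%:E; rewrite D1 mule1 => {1}<-; exact: eq_integral.
rewrite -integralB_EFin //.
apply: le_trans (le_abse_integral _ _ _) _ => //.
  apply: emeasurable_funB; apply/measurable_EFinP => //; exact: measurable_cst.
apply: le_trans (_ : \int[mu]_(z in D) (e%:E + (M * \1_E z)%:E) <= _).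
  apply: ge0_le_integral => //.
  - apply: measurableT_comp => //; apply: emeasurable_funB;
      apply/measurable_EFinP => //; exact: measurable_cst.
  - apply: emeasurable_funD => //; apply/measurable_EFinP.
    by apply: measurable_funM => //; exact: measurable_indic.
  - move=> z Dz; rewrite -EFinB abse_EFin -EFinD lee_fin /=.
    have [Ez|Ez] := pselect (E z).
      by rewrite indicE mem_set //= mulr1 (le_trans (fM _ Dz)) // lerDr.
    by rewrite indicE memNset //= mulr0 addr0 fe.
rewrite ge0_integralD //=; last 2 first.
- by move=> z _; rewrite lee_fin mulr_ge0.
- by apply/measurable_EFinP; apply: measurable_funM => //; exact: measurable_indic.
rewrite integral_cst // D1 mule1 leeD2l //.
under eq_integral do rewrite EFinM.
rewrite ge0_integralZl //; last first.
  by apply/measurable_EFinP; exact: measurable_indic.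
rewrite integral_indic // lee_wpmul2l ?lee_fin //.
by apply: le_measure; rewrite ?inE //; exact: measurableI.
Qed.

End ConcentrationIntegral.

Section Arcs.
Variable R : realType.
Implicit Types (t s d : R).

Lemma short_chord d : 0 < d -> exists2 e : R, 0 < e &
  forall t s, `|t - s| <= pi -> mag (expi t - expi s) < e -> `|t - s| < d.
Proof.
move=> d0; pose d' := Num.min d pi.
have d'0 : 0 < d' by rewrite lt_min d0 pi_gt0.
have d'pi : d' <= pi by rewrite ge_min lexx orbT.
have d'i : d' \in `[0, pi] by rewrite in_itv /= ltW.
have z0i : (0 : R) \in `[0, pi] by rewrite in_itv /= lexx pi_ge0.
have c1 : cos d' < 1 by rewrite -(cos0 R) ltr_cos.
(* The chord squared is [2 (1 - cos (t - s))], and [e ^ 2 <= 2 e] for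
   [e = 1 - cos d' <= 2]. *)
exists (1 - cos d'); first by rewrite subr_gt0.
move=> t s ts h; rewrite ltNge; apply/negP => dts.
have cosle : cos (t - s) <= cos d'.
  have -> : cos (t - s) = cos `|t - s|.
    have [ts0|ts0] := leP 0 (t - s); first by rewrite ger0_norm.
    by rewrite ltr0_norm // cosN.
  rewrite leNgt ltr_cos ?in_itv //= ?normr_ge0 // -leNgt.
  by rewrite (le_trans _ dts) // ge_min lexx.
have : mag (expi t - expi s) ^+ 2 = 2 * (1 - cos (t - s)).
  rewrite mag_sqr /= cosB; have := cos2Dsin2 t; have := cos2Dsin2 s.
  by move: (cos t) (sin t) (cos s) (sin s) => a b c e'; nra.
have := cos_geN1 d'; have := mag_ge0 (expi t - expi s).
move: (mag _) (cos d') (cos (t - s)) h cosle c1 => m c c' mc c'c c1 m0 c0; nra.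
Qed.

(** A set of times whose points on the circle are close to one another is
    contained in two short intervals, one in each half of the period. *)
Lemma small_arc_measure d : 0 < d -> exists2 e : R, 0 < e &
  forall V : set R, measurable V ->
    (forall t s, V t -> V s -> mag (expi t - expi s) < e) ->
    (uniform_prob (mulr_gt0 (ltr0n R 2) (pi_gt0 R)) V <= (d *+ 4)%:E)%E.
Proof.
move=> d0; have [e e0 he] := short_chord d0; exists e => // V mV hV.
have pi0 := pi_gt0 R.
have cover (a : R) : exists c : R,
    V `&` `[a, a + pi] `<=` `[c - d, c + d]%classic.
  have [[c [Vc hc]]|n] := pselect (V `&` `[a, a + pi] !=set0); last first.
    by exists 0 => x hx; exfalso; apply: n; exists x.
  exists c => x [Vx hx] /=; have := he x c _ (hV _ _ Vx Vc).
  move: hx hc; rewrite /= !in_itv /= => /andP[x1 x2] /andP[c1 c2].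
  rewrite ler_norml => /(_ _)-h.
  have /h : (- pi <= x - c <= pi) by apply/andP; split; lra.
  by rewrite ltr_norml => /andP[? ?]; apply/andP; split; lra.
have [c1 h1] := cover 0; have [c2 h2] := cover pi.
rewrite /uniform_prob integral_uniform_pdf.
have m2 (c : R) : measurable `[c - d, c + d]%classic by exact: measurable_itv.
apply: (@le_trans _ _ (\int[lebesgue_measure]_(x in
   `[(c1 - d)%R, (c1 + d)%R] `|` `[(c2 - d)%R, (c2 + d)%R]) (uniform_pdf 0 (2 * pi) x)%:E)%E).
  apply: ge0_subset_integral.
  - by apply: measurableI.
  - exact: measurableU.
  - apply/measurable_EFinP; apply: measurable_funTS; exact: measurable_uniform_pdf.
  - by move=> x _; rewrite lee_fin uniform_pdf_ge0 // mulr_gt0.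
  - move=> x [Vx] /=; rewrite in_itv /= => /andP[x0 x2].
    have [xp|xp] := leP x pi.
      by left; apply: h1; split=> //=; rewrite in_itv /= x0 add0r.
    by right; apply: h2; split=> //=; rewrite in_itv /= ltW //=; lra.
apply: (@le_trans _ _ (\int[lebesgue_measure]_(x in
   `[(c1 - d)%R, (c1 + d)%R] `|` `[(c2 - d)%R, (c2 + d)%R]) (cst 1 x)%:E)%E).
  apply: ge0_le_integral => //.
  - exact: measurableU.
  - by move=> x _; rewrite lee_fin uniform_pdf_ge0 // mulr_gt0.
  - apply/measurable_EFinP; apply: measurable_funTS; exact: measurable_uniform_pdf.
  - by apply/measurable_EFinP; exact: measurable_cst.
  - move=> x _; rewrite lee_fin /uniform_pdf; case: ifP => // _.
    by rewrite subr0 invf_le1 ?mulr_gt0 //; have := pi_ge2 R; lra.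
have := @integral_cst _ _ _ lebesgue_measure _ (measurableU _ _ (m2 c1) (m2 c2)) 1%:E.
rewrite mul1e => ->.
apply: le_trans (measureU2 _ _ _) _ => //.
rewrite /= !lebesgue_measure_itv /= !lte_fin.
have l (c : R) : c - d < c + d by lra.
rewrite !l -!EFinB -EFinD lee_fin; lra.
Qed.

End Arcs.

Section Represents.
Variable R : realType.
Implicit Types (G : disc_mobius R) (z y : C R).

Lemma center_offset G z : circle R z ->
  mag (G z - G 0) * (mag (mob_alpha G) * den G z) = 1.
Proof.
move=> hz; rewrite -(mag_conj (mob_alpha G)) /den -!magM.
have a0 : (mob_alpha G)^* != 0.
  by rewrite conjC_eq0 -mag_eq0 gt_eqF ?mag_alpha_gt0.
rewrite -((circleP z).1 hz); congr mag.
have := mob_den_neq0 G hz; have := mob_axiom G; rewrite !normCK /mob_fun.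
rewrite !mulr0 !add0r => ab n0; rewrite -[RHS]mul1r -ab; field.
by rewrite a0 n0.
Qed.

Lemma den_separation G z z' :
  mag (mob_beta G) * mag (z - z') <= den G z + den G z'.
Proof.
rewrite -mag_conj -magM /den -[X in _ <= _ + X]magN.
by apply: le_trans (magD _ _); rewrite le_eqVlt; apply/orP; left; apply/eqP; congr mag; ring.
Qed.

(** When the image of the centre is near [y], the points that are not sent near
    [y] are close to one another: at all of them the denominator is small. *)
Lemma far_points_close (d e : R) : 0 < d -> 0 < e -> exists2 e' : R, 0 < e' &
  forall G y, circle R y -> den (mob_inv G) y < e' * mag (mob_alpha G) ->
  forall z z', circle R z -> circle R z' ->
    d <= mag (G z - y) -> d <= mag (G z' - y) -> mag (z - z') < e.
Proof.
(* At far points the denominator is at most [2 / (d |alpha|)], hence they are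
   within [4 / (d |alpha| |beta|)] of one another; on the other hand
   [1 = (|alpha| - |beta|) (|alpha| + |beta|) < 2 e' |alpha| ^ 2]. *)
move=> d0 e0; exists (Num.min (1 / 4) (Num.min (d / 2) (d * e / 16))).
  by rewrite !lt_min; apply/and3P; split; rewrite ?divr_gt0 ?mulr_gt0.
move=> G y hy; set e' := Num.min _ _ => hG z z' hz hz' dz dz'.
have e1 : e' <= 1 / 4 by rewrite /e' ge_min lexx.
have e2 : e' <= d / 2 by rewrite /e' !ge_min lexx orbT.
have e3 : e' <= d * e / 16 by rewrite /e' !ge_min lexx !orbT.
have e'0 : 0 < e' by rewrite !lt_min; apply/and3P; split; rewrite ?divr_gt0 ?mulr_gt0.
have a0 := mag_alpha_gt0 G; have b0 := mag_ge0 (mob_beta G).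
have ab := mag_alpha_sqr G; have ba := mag_beta_lt G.
have far x : circle R x -> d <= mag (G x - y) ->
    d * (mag (mob_alpha G) * den G x) <= 2.
  move=> hx dx; have c1 := center_offset G hx.
  have c2 : mag (y - G 0) < e'.
    by rewrite -(ltr_pM2r a0) mob_center_dist.
  have := magD (G x - G 0) (G 0 - y); rewrite addrA subrK (magB (G 0)) => c3.
  have c4 : d / 2 <= mag (G x - G 0) by lra.
  have p0 : 0 < mag (mob_alpha G) * den G x by rewrite mulr_gt0 // den_gt0.
  have : d / 2 * (mag (mob_alpha G) * den G x) <=
    mag (G x - G 0) * (mag (mob_alpha G) * den G x) by rewrite ler_pM2r.
  by rewrite c1; lra.
have f1 := far _ hz dz; have f2 := far _ hz' dz'.
have sep := den_separation G z z'.
have lb := den_ge (mob_inv G) hy; rewrite /= mag_conj magN in lb.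
have m0 := mag_ge0 (z - z').
move: (mag (z - z')) (den G z) (den G z') (den (mob_inv G) y) m0 sep f1 f2 lb hG.
move: (mag (mob_alpha G)) (mag (mob_beta G)) a0 b0 ab ba.
move=> a b a0 b0 ab ba m u v w m0 sep f1 f2 lb hG.
have h1 : a - b < e' * a by lra.
have h2 : 1 < 2 * e' * a ^+ 2.
  have : (a - b) * (a + b) < e' * a * (a + b) by rewrite ltr_pM2r //; lra.
  have : e' * a * (a + b) <= e' * a * (a * 2) by rewrite ler_pM2l ?mulr_gt0 //; lra.
  have -> : (a - b) * (a + b) = 1 by rewrite -subr_sqr ab addrK.
  have -> : e' * a * (a * 2) = 2 * e' * a ^+ 2 by ring.
  by lra.
have h3 : 2 < a ^+ 2.
  have : 2 * e' * a ^+ 2 <= 1 / 2 * a ^+ 2 by rewrite ler_pM2r ?exprn_gt0 //; lra.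
  by lra.
have h4 : a <= 2 * b by nra.
have h5 : d * (a * (b * m)) <= 4.
  have : d * (a * (b * m)) <= d * (a * (u + v)) by rewrite !ler_pM2l.
  by rewrite !mulrDr; lra.
have h6 : d * (a * (a * m)) <= 8.
  have : d * (a * (a * m)) <= d * (a * ((2 * b) * m)).
    by rewrite !ler_pM2l // ler_wpM2r.
  have -> : d * (a * ((2 * b) * m)) = 2 * (d * (a * (b * m))) by ring.
  lra.
rewrite ltNge; apply/negP => em.
have h7 : d * (a * (a * e)) <= 8.
  by apply: le_trans h6; rewrite !ler_pM2l.
have : 2 * e' * a ^+ 2 <= 2 * (d * e / 16) * a ^+ 2.
  by rewrite ler_pM2r ?exprn_gt0 // ler_pM2l.
have -> : 2 * (d * e / 16) * a ^+ 2 = d * (a * (a * e)) / 8 by field.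
lra.
Qed.

Lemma borel_open (U : set (C R)) : open U -> measurable (U : set (borelC R)).
Proof. exact: sub_sigma_algebra. Qed.

Lemma measurable_circle : measurable (circle R : set (borelC R)).
Proof.
rewrite -[circle R]setCK; apply: measurableC; apply: borel_open.
exact/closed_openC/closed_circle.
Qed.

Lemma measurable_on_circle (f : C R -> R) : {within circle R, continuous f} ->
  measurable_fun (circle R : set (borelC R)) (f : borelC R -> R).
Proof.
move=> /continuousP cf; apply: (measurability _ (RGenOpens.measurableE R)).
move=> _ [_ [a [b ->] <-]].
have /cf /open_subspaceP [V oV VD] : open (`]a, b[%classic : set R).
  exact: interval_open.
rewrite setIC -VD; apply: measurableI; [exact: borel_open | exact: measurable_circle].
Qed.

Lemma measurable_mob_expi G :
  measurable_fun setT ((fun t => G (expi t)) : R -> borelC R).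
Proof.
have := @measurability _ _ R (borelC R) setT (fun t => G (expi t)) (@open (C R)) (erefl _).
apply => _ [U oU <-].
rewrite setTI; apply: open_measurable; apply: open_comp oU => t _.
apply: (@continuous_comp _ _ _ (@expi R : R -> C R) (G : C R -> C R)).
  exact: continuous_expi.
exact/continuous_mob/expi_circle.
Qed.

Lemma bounded_on_circle (f : C R -> R) y : {within circle R, continuous f} ->
  exists2 M : R, 0 < M & forall z, circle R z -> `|f z - f y| <= M.
Proof.
move=> /continuous_compact/(_ (@compact_circle R)) /compact_bounded [N [_ hN]].
pose M := Num.max 1 (N + 1); have NM : N < M by rewrite lt_max ltrDl ltr01 orbT.
exists (M + `|f y|); first by rewrite ltr_wpDr // lt_max ltr01.
move=> z hz; apply: le_trans (ler_normB _ _) _; rewrite lerD2r.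
by apply: hN NM _ _; exists z.
Qed.

Lemma continuous_on_circle (f : C R -> R) y (e : R) : {within circle R, continuous f} ->
  circle R y -> 0 < e -> exists2 d : R, 0 < d &
  forall z, circle R z -> mag (z - y) < d -> `|f z - f y| <= e.
Proof.
move=> cf hy e0; have : f @ within (circle R) (nbhs y) --> f y.
  by rewrite (nbhs_subspace_in hy); exact: cf.
move=> /cvgrPdist_le /(_ e e0).
rewrite /within /= => /nbhs_magP [d d0 hd].
by exists d => // z hz zy; rewrite distrC; apply: hd.
Qed.

Lemma cvge_close (u : (\bar R)^nat) (c : R) :
  (forall e : R, 0 < e -> exists K, forall n, (K <= n)%N ->
     (`|u n - c%:E| <= e%:E)%E) ->
  u @ \oo --> c%:E.
Proof.
move=> h.
have fin n (e : R) : (`|u n - c%:E| <= e%:E)%E -> exists2 r, u n = r%:E & `|r - c| <= e.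
  by case: (u n) => [r||] //=; rewrite ?lee_fin => ?; exists r.
apply/fine_cvgP; split.
  have [K hK] := h 1 ltr01; exists K => // n /= /hK /fin [r -> _] //.
apply/cvgrPdist_le => e e0; have [K hK] := h e e0.
by exists K => // n /= /hK /fin [r -> re]; rewrite distrC.
Qed.

(** The points that are sent far from [y] form a short arc, of small measure,
    and a continuous function on the circle is bounded. *)
Theorem represents_of_centers (G : nat -> disc_mobius R) y : circle R y ->
  (forall e : R, 0 < e -> exists K, forall n, (K <= n)%N ->
     den (mob_inv (G n)) y < e * mag (mob_alpha (G n))) ->
  represents G y.
Proof.
move=> hy hG; split=> // f cf.
have mf := measurable_on_circle cf.
have mC := measurable_circle.
rewrite integral_dirac //; last exact/measurable_EFinP.
rewrite diracE mem_set // mul1e.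
apply: cvge_close => e e0.
have e2 : 0 < e / 2 by lra.
have [M M0 hM] := bounded_on_circle y cf.
have [d d0 hd] := continuous_on_circle cf hy e2.
(* A set of measure [4 * (e / (8 * M))] contributes at most [e / 2]. *)
have t0 : 0 < e / (8 * M) by rewrite divr_gt0 // mulr_gt0.
have [e1 e10 he1] := small_arc_measure t0.
have [e' e'0 he'] := far_points_close d0 e10.
have [K hK] := hG e' e'0; exists K => n /hK Gn.
pose phi := ((fun t => G n (expi t)) : R -> borelC R).
have mphi : measurable_fun setT phi := measurable_mob_expi (G n).
pose P := uniform_prob (mulr_gt0 (ltr0n R 2) (pi_gt0 R)).
have -> : mob_image (G n) (@circle_unif R) = pushforward P phi by [].
pose E : set (borelC R) := [set z | d <= mag (z - y)].
have mE : measurable E.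
  rewrite -[E]setCK; apply: measurableC; apply: borel_open.
  rewrite openE => z /= /negP; rewrite -ltNge => zd.
  apply/nbhs_magP; exists (d - mag (z - y)); first by rewrite subr_gt0.
  move=> x hx; apply/negP; rewrite -ltNge.
  by have := magD (x - z) (z - y); rewrite addrA subrK; lra.
have c1 : pushforward P phi (circle R : set (borelC R)) = 1%E.
  rewrite /pushforward.
  have -> : phi @^-1` (circle R) = setT.
    apply/seteqP; split=> // t _ /=; exact/mob_circle/expi_circle.
  exact: probability_setT.
have := @integral_close _ _ _ (pushforward P phi) (circle R) E f (f y) (e / 2) M.
move=> /(_ mphi mC mE c1 mf (ltW e2) (ltW M0) hM).
have fe z : circle R z -> ~ E z -> `|f z - f y| <= e / 2.
  by move=> hz /negP; rewrite -ltNge; apply: hd.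
move=> /(_ fe) /le_trans; apply.
have PE : (pushforward P phi E <= (e / (8 * M) *+ 4)%:E)%E.
  apply: he1; first by rewrite -[X in measurable X]setTI; exact: mphi.
  by move=> t s Et Es; apply: (he' _ _ hy Gn) => //; exact: expi_circle.
apply: le_trans (leeD2l _ (lee_wpmul2l _ PE)) _.
  by rewrite lee_fin ltW.
rewrite -EFinM -EFinD lee_fin le_eqVlt; apply/orP; left; apply/eqP.
rewrite -mulr_natl; field; by rewrite gt_eqF.
Qed.

(** The distance to one of the points is a test function. *)
Lemma represents_unique (G : nat -> disc_mobius R) x y :
  represents G x -> represents G y -> x = y.
Proof.
move=> [hx rx] [hy ry].
pose f z := mag (z - x).
have cf : {within circle R, continuous f}.
  by apply: continuous_subspaceT; exact: continuous_mag_sub.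
have mf := measurable_on_circle cf.
have mC := measurable_circle.
have /(_ (@ereal_hausdorff R) _) := cvg_unique _ (rx f cf) (ry f cf).
rewrite !integral_dirac //; try exact/measurable_EFinP.
rewrite !diracE !mem_set // !mul1e => -[]; rewrite /f subrr mag0 => /esym/eqP.
by rewrite mag_eq0 subr_eq0 => /eqP.
Qed.

End Represents.

(** * Words and refined sets *)

Section Words.
Variable A : finType.
Implicit Types (w : infword A) (v : seq A) (S : set (infword A)).

Definition shiftn (n : nat) w : infword A := fun i => w (n + i)%N.

Lemma wprefixS w n : wprefix w n.+1 = rcons (wprefix w n) (w n).
Proof. exact: mkseqS. Qed.

Lemma wprefixD w m n : wprefix w (m + n) = wprefix w m ++ wprefix (shiftn m w) n.
Proof.
elim: n => [|n IH]; first by rewrite addn0 cats0.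
by rewrite addnS !wprefixS IH rcons_cat.
Qed.

Lemma wprefix_take w m n : (m <= n)%N -> take m (wprefix w n) = wprefix w m.
Proof.
move=> mn; rewrite -(subnKC mn) wprefixD take_size_cat //.
by rewrite size_mkseq.
Qed.

Lemma subshift_shiftn S n w : subshift S -> S w -> S (shiftn n w).
Proof.
move=> [_ sS]; elim: n w => [|n IH] w Sw; first by [].
have Sw' : S (wshift w) by apply: sS; exists w.
have -> : shiftn n.+1 w = shiftn n (wshift w) by apply: funext.
exact: IH.
Qed.

Lemma language_catl S u v : language S (u ++ v) -> language S u.
Proof.
move=> [w [k [Sw e]]]; exists w, k; split=> //.
have e' : take (size u) (wprefix (shiftn k w) (size (u ++ v))) = u.
  by rewrite [wprefix _ _](esym e) take_size_cat.
by rewrite -{1}e' wprefix_take // size_cat leq_addr.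
Qed.

Lemma cylinder_wprefix w w' n :
  cylinder (wprefix w n) w' = (wprefix w' n = wprefix w n).
Proof. by rewrite /cylinder /= size_mkseq. Qed.

Lemma nbhs_cylinder w n : nbhs w (cylinder (wprefix w n)).
Proof.
elim: n => [|n IH].
  by apply: filterS filterT => w' _.
have H : nbhs w [set w' : infword A | w' n = w n].
  have := @proj_continuous nat (fun=> discrete_topology A) n w.
  by move=> c; apply: (c [set w n]); exact: discrete_set1.
apply: filterS2 IH H => w'; rewrite !cylinder_wprefix /= => e1 e2.
by rewrite !wprefixS e1 e2.
Qed.

Lemma cylinder_basis w (U : set (infword A)) : nbhs w U ->
  exists n, cylinder (wprefix w n) `<=` U.
Proof.
pose G := filter_from setT (fun n => cylinder (wprefix w n)).
have FG : Filter G.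
  apply: filter_from_filter; first by exists 0%N.
  move=> m n _ _; exists (maxn m n) => // w'; rewrite cylinder_wprefix => e.
  by split; rewrite cylinder_wprefix; [rewrite -(wprefix_take w' (leq_maxl m n))|
             rewrite -(wprefix_take w' (leq_maxr m n))]; rewrite e wprefix_take //
     ?leq_maxl ?leq_maxr.
suff cv : G --> w by move=> /cv [n _ h]; exists n.
apply/cvg_sup => i V.
rewrite (@nbhsE (initial_topology (fun f : infword A => f i)) w).
move=> [B [[Q oQ <-] Qw] BV]; exists i.+1 => // w'.
rewrite cylinder_wprefix !wprefixS => /rcons_inj [_ e].
by apply: BV => /=; rewrite e.
Qed.

Lemma closed_by_prefixes S w : closed S ->
  (forall n, exists2 w', S w' & wprefix w' n = wprefix w n) -> S w.
Proof.
move=> cS h; apply: cS => U /cylinder_basis [n hn].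
have [w' Sw' e] := h n; exists w'; split=> //; apply: hn.
by rewrite cylinder_wprefix.
Qed.

End Words.

Section Refined.
Variables (R : realType) (A : finType) (F : A -> disc_mobius R)
  (W : A -> set (C R)).
Hypothesis W_circle : forall a, W a `<=` circle R.
Implicit Types (u v : seq A).

Lemma word_mob_cat u v :
  word_mob F (u ++ v) = mob_comp (word_mob F u) (word_mob F v).
Proof.
elim: u => [|a u IH] /=; first by rewrite mob_1comp.
by rewrite IH mob_compA.
Qed.

Lemma refined_circle u : refined F W u `<=` circle R.
Proof. by move=> x []. Qed.

Lemma refined_nil : refined F W [::] = circle R.
Proof. by apply/seteqP; split=> x; [case | split=> // -[]]. Qed.

Lemma refined_catl u v : refined F W (u ++ v) `<=` refined F W u.
Proof.
move=> x [hx h]; split=> // p a s e; apply: (h p a (s ++ v)).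
by rewrite e -catA.
Qed.

Lemma refined_catr u v x : refined F W (u ++ v) x ->
  refined F W v (mob_inv (word_mob F u) x).
Proof.
move=> [hx h]; split=> [|p a s e]; first exact: mob_circle.
have [|z Wz <-] := h (u ++ p) a s; first by rewrite e catA.
have hz := W_circle Wz; exists z => //.
by rewrite word_mob_cat mob_compE // mob_invK //; exact: mob_circle.
Qed.

Lemma interval_shift_subshift (S : set (infword A)) : subshift S ->
  subshift (interval_shift F W S).
Proof.
move=> sS; have [cS shS] := sS; split.
- move=> w cw; split.
    apply: cS; apply: closureS cw => w' [].
    by [].
  move=> n; have [w' [[_ h]]] := cw _ (nbhs_cylinder w n).
  by rewrite cylinder_wprefix => <-.
- move=> _ [w [Sw h] <-]; split; first by apply: shS; exists w.
  move=> n; have [x] := h (1 + n)%N; rewrite wprefixD => /refined_catr.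
  by move=> hx; eexists; exact: hx.
Qed.

End Refined.

(** * The number system *)

Section NumberSystem.
Variables (R : realType) (A : finType) (F : A -> disc_mobius R)
  (B : set (seq A)) (W : A -> set (C R)) (S : set (infword A)).
Hypotheses (B_finite : finite_set B) (B_nonempty : ~ B [::])
  (W_circle : forall a, W a `<=` circle R) (S_subshift : subshift S)
  (B_expanding : forall b, B b ->
     refined F W b `<=` expansion_interval (mob_inv (word_mob F b)))
  (B_prefix : forall w, interval_shift F W S w ->
     exists2 b, B b & cylinder b w).
Implicit Types (w : infword A) (y : C R).

(** A cut of [w] into words of [B]: the [k]-th word starts at [pos k]. *)
Lemma factorization w : interval_shift F W S w ->
  exists (b : nat -> seq A) (pos : nat -> nat),
    [/\ forall k, B (b k), pos 0%N = 0%N,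
        forall k, pos k.+1 = (pos k + size (b k))%N,
        forall k, (0 < size (b k))%N &
        forall k, wprefix w (pos k.+1) = wprefix w (pos k) ++ b k].
Proof.
move=> Sw.
have sh := interval_shift_subshift F W_circle S_subshift.
have /choice [f hf] : forall n, exists b, B b /\ cylinder b (shiftn n w).
  move=> n; have [b Bb cb] := B_prefix (subshift_shiftn n sh Sw).
  by exists b.
pose pos := fix pos k := if k is k'.+1 then (pos k' + size (f (pos k')))%N else 0%N.
exists (fun k => f (pos k)), pos; split=> // k; first by case: (hf (pos k)).
- by case: (hf (pos k)); case: (f (pos k)).
- by rewrite /= wprefixD; case: (hf (pos k)) => _ ->.
Qed.

Lemma block_index (pos : nat -> nat) (size : nat -> nat) n : pos 0%N = 0%N ->
  (forall k, pos k.+1 = (pos k + size k)%N) -> (forall k, (0 < size k)%N) ->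
  exists k, (pos k <= n < pos k + size k)%N.
Proof.
move=> p0 pS s0; elim: n => [|n [k /andP[h1 h2]]].
  by exists 0%N; rewrite p0 s0.
have [h3|h3] := ltnP n.+1 (pos k + size k)%N.
  by exists k; rewrite h3 leqW.
by exists k.+1; rewrite pS h3 /= -addn1 leq_add.
Qed.

Lemma block_distortion : exists2 M : R, 0 < M &
  forall b l, B b -> mag (mob_alpha (word_mob F (take l b))) <= M.
Proof.
have /finite_seqP [s Bs] := B_finite.
pose L := \max_(j : seq_sub s) size (ssval j).
have [M M0 hM] := finite_ub (fun p : seq_sub s * 'I_L.+1 =>
  mag (mob_alpha (word_mob F (take p.2 (ssval p.1))))).
exists M => // b l; rewrite Bs /= => bs.
have [lb|bl] := leqP l (size b).
  have lL : (l < L.+1)%N.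
    by rewrite ltnS (leq_trans lb) // (leq_bigmax (SeqSub bs)).
  exact: (hM (SeqSub bs, Ordinal lL)).
have bL : (size b < L.+1)%N by rewrite ltnS (leq_bigmax (SeqSub bs)).
have := hM (SeqSub bs, Ordinal bL); rewrite /= take_size take_oversize //.
exact: ltnW.
Qed.

(** Cutting the word into blocks of [B] gives a sequence of maps, taken from a
    finite family, to which the convergence of the centres applies; inside a
    block the distortion is bounded. *)
Lemma represents_common_point w y : interval_shift F W S w ->
  (forall n, closure (refined F W (wprefix w n)) y) ->
  represents (fun n => word_mob F (wprefix w n.+1)) y.
Proof.
move=> Sw cy; have hy : circle R y.
  by apply: closed_circle; apply: closureS (cy 0%N) => z [].
have [b [pos [Bb p0 pS b0 wb]]] := factorization Sw.
have /finite_seqP [s Bs] := B_finite.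
have bs k : b k \in s by have := Bb k; rewrite Bs.
pose h (j : seq_sub s) := mob_inv (word_mob F (ssval j)).
pose i k : seq_sub s := SeqSub (bs k).
pose g k := h (i k).
have pathE k : path_mob g k = mob_inv (word_mob F (wprefix w (pos k))).
  elim: k => [|k IH]; first by rewrite p0 /= mob_inv1.
  by rewrite /= IH wb word_mob_cat mob_inv_comp.
have posm k m : (pos k <= pos (k + m)%N)%N.
  by elim: m => [|m IH]; rewrite ?addn0 // addnS pS (leq_trans IH) // leq_addr.
have app : expansively_approached g y.
  move=> k e e0; have [z Uz zy] := (closure_magP _ _).1 (cy (pos k)) e e0.
  exists z; split=> //; first exact: refined_circle Uz.
  move=> j jk; apply: expansion_den; apply: B_expanding; first exact: Bb.
  rewrite pathE; apply: (refined_catr W_circle); rewrite -wb.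
  move: Uz; rewrite -(subnKC jk).
  rewrite -(subnKC (posm j.+1 (k - j.+1)%N)) wprefixD; exact: refined_catl.
have cc := centers_converge hy app.
have [M M0 hM] := block_distortion.
apply: represents_of_centers => // e e0.
(* An incomplete block multiplies [den] by at most [2 M] and divides the size
   of [alpha] by at most [2 M]. *)
have e'0 : 0 < e / (4 * M ^+ 2) by rewrite divr_gt0 // mulr_gt0 // exprn_gt0.
have [K hK] := cc _ e'0; exists (pos K) => n Kn.
have [k /andP[kn nk]] := block_index n.+1 p0 pS b0.
have Kk : (K <= k)%N.
  rewrite leqNgt; apply/negP => kK.
  have := posm k.+1 (K - k.+1)%N; rewrite subnKC // pS => h1.
  have := leq_trans nk (leq_trans h1 Kn).
  by rewrite ltnNge leqnSn.
pose l := (n.+1 - pos k)%N.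
have wn : wprefix w n.+1 = wprefix w (pos k) ++ take l (b k).
  have := wprefix_take w (ltnW nk); rewrite -pS wb take_cat size_mkseq.
  by rewrite ltnNge kn /= => <-.
have hk := hK k Kk; rewrite pathE /= mag_conj in hk.
rewrite wn word_mob_cat mob_inv_comp den_comp //.
have hy' := mob_circle (mob_inv (word_mob F (wprefix w (pos k)))) hy.
have d1 := den_le (mob_inv (word_mob F (take l (b k)))) hy'.
rewrite /= mag_conj magN in d1.
have d2 := mag_beta_lt (word_mob F (take l (b k))).
have d3 := hM (b k) l (Bb k).
have d4 := mag_alpha_comp (word_mob F (wprefix w (pos k))) (word_mob F (take l (b k))).
have d5 := mag_ge0 (mob_alpha (word_mob F (take l (b k)))).
have d6 := den_gt0 (mob_inv (word_mob F (wprefix w (pos k)))) hy.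
have d7 := mag_ge0 (mob_alpha
  (mob_comp (word_mob F (wprefix w (pos k))) (word_mob F (take l (b k))))).
move: d1 d2 d3 d4 d5 hk d6 d7.
move: (den _ _) (den (mob_inv (word_mob F (wprefix _ _))) y) (mag (mob_beta _))
  (mag (mob_alpha (mob_comp _ _)))
  (mag (mob_alpha (word_mob F (take _ _)))) (mag (mob_alpha (word_mob F (wprefix _ _)))).
move=> D P bt q p a d1 d2 d3 d4 d5 hk d6 d7.
have D2 : D <= 2 * M by lra.
have aq : a <= q * (2 * M).
  by apply: le_trans d4 _; apply: ler_wpM2l => //; lra.
have h1 : D * P <= 2 * M * P by rewrite ler_pM2r.
have h2 : 2 * M * P < 2 * M * (e / (4 * M ^+ 2) * a) by rewrite ltr_pM2l ?mulr_gt0.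
have h3 : 2 * M * (e / (4 * M ^+ 2) * a) <= 2 * M * (e / (4 * M ^+ 2) * (q * (2 * M))).
  rewrite ler_pM2l ?mulr_gt0 //; apply: ler_wpM2l aq; exact: ltW.
have h4 : 2 * M * (e / (4 * M ^+ 2) * (q * (2 * M))) = e * q.
  by field; rewrite gt_eqF.
by rewrite -h4; apply: le_lt_trans h1 (lt_le_trans h2 h3).
Qed.

Lemma Phi_eq w y : represents (fun n => word_mob F (wprefix w n.+1)) y ->
  Phi F w = y.
Proof. by move=> h; apply: xget_unique => // x hx; apply: represents_unique hx h. Qed.

Lemma refined_wprefix_nested w m n : (m <= n)%N ->
  refined F W (wprefix w n) `<=` refined F W (wprefix w m).
Proof. by move=> mn; rewrite -(subnKC mn) wprefixD; exact: refined_catl. Qed.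

Lemma Phi_common_point w y : interval_shift F W S w ->
  (forall n, closure (refined F W (wprefix w n)) y) -> Phi F w = y.
Proof. by move=> Sw cy; apply/Phi_eq/represents_common_point. Qed.

Lemma Phi_closure w : interval_shift F W S w ->
  forall n, closure (refined F W (wprefix w n)) (Phi F w).
Proof.
move=> Sw; have [|||x _ cx] := @nested_closures _ (fun n => refined F W (wprefix w n)).
- by move=> n; exact: refined_circle.
- exact: refined_wprefix_nested.
- by case: Sw.
by rewrite (Phi_common_point Sw cx).
Qed.

(** The sets [W_(w_[0,n))] shrink to [Phi w], and they depend on a prefix of
    [w] only. *)
Lemma Phi_continuous : {within interval_shift F W S, continuous (Phi F)}.
Proof.
apply/subspace_continuousP => w Sw.
move=> V /nbhs_magP [e e0 hV].
have [||x _ hx|n hn] := @nested_closures_shrink _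
  (fun n => refined F W (wprefix w n)) (Phi F w) _ _ _ e e0.
- by move=> n; exact: refined_circle.
- exact: refined_wprefix_nested.
- by rewrite (Phi_common_point Sw hx).
apply: filterS (nbhs_cylinder w n) => w'; rewrite cylinder_wprefix => e' Sw'.
by apply: hV; apply: hn; rewrite -e'; exact: Phi_closure.
Qed.

Hypothesis W_compatible : forall v, language S v ->
  closure (refined F W v) =
  \bigcup_(a in [set a | language S (rcons v a)]) closure (refined F W (rcons v a)).

(** Compatibility allows one to extend a word of the language one letter at a
    time while keeping a given point in the closures of the refined sets. *)
Lemma infinite_extension v y : language S v -> closure (refined F W v) y ->
  exists w, [/\ S w, cylinder v w & forall n, closure (refined F W (wprefix w n)) y].
Proof.
move=> Lv cy.
pose good u := language S u /\ closure (refined F W u) y.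
have step u : good u -> exists a, good (rcons u a).
  move=> [Lu cu]; have := cu; rewrite W_compatible // => -[a La ca].
  by exists a.
have [a0 _] := step v (conj Lv cy).
have /choice [st hst] : forall u, exists a, good u -> good (rcons u a).
  move=> u; have [/step [a ga]|n] := pselect (good u); first by exists a.
  by exists a0.
pose vs n := iter n (fun u => rcons u (st u)) v.
have gvs n : good (vs n) by elim: n => [|n IH] //=; exact: hst.
have szvs n : size (vs n) = (size v + n)%N.
  by elim: n => [|n IH]; rewrite ?addn0 //= size_rcons IH addnS.
have nthvs n m i : (i < size v + n)%N -> nth a0 (vs (n + m)%N) i = nth a0 (vs n) i.
  move=> hi; elim: m => [|m IH]; first by rewrite addn0.
  by rewrite addnS /= nth_rcons szvs addnA ltn_addr.
pose w : infword A := fun i => nth a0 (vs i.+1) i.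
have wvs n : wprefix w (size v + n) = vs n.
  apply: (@eq_from_nth _ a0); first by rewrite size_mkseq szvs.
  move=> i; rewrite size_mkseq => hi; rewrite nth_mkseq // /w.
  have [h|h] := leqP i.+1 n.
    by rewrite -(subnKC h) [RHS]nthvs // addnS ltnS leq_addl.
  by rewrite -(subnKC (ltnW h)) nthvs.
have gw n : good (wprefix w n).
  have [Lg cg] := gvs n.
  have e : vs n = wprefix w n ++ wprefix (shiftn n w) (size v).
    by rewrite -wprefixD addnC wvs.
  split; first by move: Lg; rewrite e; exact: language_catl.
  by apply: closureS cg; rewrite e; exact: refined_catl.
exists w; split=> [||n]; last by case: (gw n).
- have [cS _] := S_subshift; apply: closed_by_prefixes => // n.
  have [[w' [k [Sw' e]]] _] := gw n; exists (shiftn k w').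
    exact: subshift_shiftn.
  by rewrite e size_mkseq.
- by rewrite /cylinder /= -[size v]addn0 wvs.
Qed.

Lemma Phi_cylinder v : language S v ->
  Phi F @` (cylinder v `&` interval_shift F W S) = closure (refined F W v).
Proof.
move=> Lv; apply/seteqP; split=> [_ [w [vw Sw] <-]|y cy].
  by rewrite -[v in X in closure X]vw; exact: Phi_closure.
have [w [Sw vw cw]] := infinite_extension Lv cy.
have Iw : interval_shift F W S w.
  by split=> // n; have [z Uz _] := (closure_magP _ _).1 (cw n) 1 ltr01; exists z.
by exists w => //; exact: Phi_common_point.
Qed.

End NumberSystem.

Theorem corollary27 (R : realType) (A : finType) (F : A -> disc_mobius R)
    (B : set (seq A)) (W : A -> set (C R)) (Sigma : set (infword A))
    (B_finite : finite_set B) (B_nonempty_words : ~ B [::])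
    (W_cover : interval_almost_cover W)
    (Sigma_compatible : compatible F W Sigma)
    (B_expanding : forall b, B b ->
       refined F W b `<=` expansion_interval (mob_inv (word_mob F b)))
    (B_prefix : forall w, interval_shift F W Sigma w ->
       exists2 b, B b & cylinder b w) :
  mobius_number_system F (interval_shift F W Sigma) /\
  forall v : seq A, language Sigma v ->
    Phi F @` (cylinder v `&` interval_shift F W Sigma) =
    closure (refined F W v).
Proof.
have [S_subshift [w0 Sw0] W_compatible] := Sigma_compatible.
have W_circle a : W a `<=` circle R.
  have [/(_ a) [I ->] _] := W_cover.
  by move=> _ [p _ [t _ <-]]; exact: expi_circle.
have cyl := Phi_cylinder B_finite B_nonempty_words W_circle S_subshift
  B_expanding B_prefix W_compatible.
split=> //; split.
- exact: interval_shift_subshift.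
- move=> w Sw; exists (Phi F w).
  apply: (represents_common_point B_finite B_nonempty_words W_circle S_subshift
    B_expanding B_prefix Sw).
  exact: (Phi_closure B_finite B_nonempty_words W_circle S_subshift
    B_expanding B_prefix Sw).
- have L0 : language Sigma [::] by exists w0, 0%N.
  have := cyl _ L0; rewrite refined_nil -(closure_id _).1; last exact: closed_circle.
  by move=> <-; congr (_ @` _); apply/seteqP; split=> w // [].
- exact: (Phi_continuous B_finite B_nonempty_words W_circle S_subshift
    B_expanding B_prefix).
Qed.
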